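(* Let $\mathrm{Prob}$ be a probability measure on $\overline{\triangle}$, absolutely continuous with respect to the Lebesgue measure. Let $(a_n(S))_{n\ge0}$ be the sequence of positive real numbers realising the pointwise dual ergodicity of $(\overline{\triangle},\mu,S)$. If $(a_n(S))_{n\ge 0}$ is regularly varying of index $\alpha=1$, then for all $f\in L^1(\overline{\triangle},\mu)$ and for all $\varepsilon>0$ $$\lim_{n\to\infty}\mathrm{Prob}\left(\left|\frac{1}{a_n(S)}\sum_{k=0}^{n-1}(f\circ S^k)(x,y)-\int_{\overline{\triangle}}f\,d\mu\right|>\varepsilon\right)=0.$$
   Context: $\overline{\triangle}=\{(x,y)\in\mathbb{R}^2: 1\ge x\ge y\ge 0\}$, $\Gamma_0=\{(x,y)\in\mathbb{R}^2: 1\ge x\ge y>1-x\}$, $\Gamma_1=\overline{\triangle}\setminus\Gamma_0=\{(x,y): 1-y\ge x\ge y\ge 0\}$. The map $S:\overline{\triangle}\to\overline{\triangle}$ is $S(x,y)=\left(\frac{y}{x},\frac{1-x}{x}\right)$ if $(x,y)\in\Gamma_0$ and $S(x,y)=\left(\frac{x}{1-y},\frac{y}{1-y}\right)$ if $(x,y)\in\Gamma_1$. The measure $\mu$ is the infinite, ergodic, conservative $S$-invariant measure on $\overline{\triangle}$ with density $\frac{1}{xy}$ with respect to Lebesgue measure. $\widehat{S}:L^1(\mu)\to L^1(\mu)$ is the transfer (dual) operator, determined by $\int (\widehat{S}f)\,g\,d\mu=\int f\,(g\circ S)\,d\mu$ for all $f\in L^1(\mu)$, $g\in L^\infty(\mu)$.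 The system $(\overline{\triangle},\mu,S)$ is pointwise dual ergodic, and $(a_n(S))_{n\ge0}$ denotes a sequence of positive real numbers such that $\lim_{n\to\infty}\frac{1}{a_n(S)}\sum_{k=0}^{n-1}\widehat{S}^k f=\int f\,d\mu$ $\mu$-almost everywhere for all $f\in L^1(\overline{\triangle},\mu)$; it satisfies $a_n(S)\asymp\frac{n}{\log^2 n}$ (where $a_n\asymp b_n$ means $a_n=O(b_n)$ and $b_n=O(a_n)$). A sequence $(a_n)_{n\ge0}$ is regularly varying of index $\alpha\in\mathbb{R}$ if $\lim_{n\to\infty}\frac{a_{\lfloor cn\rfloor}}{a_n}=c^\alpha$ for all $c>0$. *)

(* Defs.v *)
From HB Require Import structures.
From mathcomp Require Import all_boot all_order all_algebra.
From mathcomp Require Import all_classical all_reals all_analysis.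
From mathcomp Require Import measurable_realfun ess_sup_inf.

Set Implicit Arguments.
Unset Strict Implicit.
Unset Printing Implicit Defensive.

Import Order.TTheory GRing.Theory Num.Theory.
Import numFieldNormedType.Exports.

Local Open Scope classical_set_scope.
Local Open Scope ring_scope.

(* Regular variation of index alpha; Num.truncn (c * n%:R) is the integer part
   of c * n, which is a natural number when 0 < c. *)
Definition regularly_varying (R : realType) (a : R^nat) (alpha : R) : Prop :=
  forall c : R, 0 < c ->
    (fun n : nat => a (Num.truncn (c * n%:R)) / a n) @ \oo --> c `^ alpha.

(* lebesgue_measure lives on measurableTypeR R, which is R with its Borel sets. *)
Definition plane (R : realType) : measurableType _ :=
  (measurableTypeR R * measurableTypeR R)%type.

Section triangle_map.
Context (R : realType).
Implicit Types z : plane R.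

Definition triangle : set (plane R) :=
  [set z | let x : R := z.1 in let y : R := z.2 in [/\ 1 >= x, x >= y & y >= 0]].

Definition Gamma0 : set (plane R) :=
  [set z | let x : R := z.1 in let y : R := z.2 in
    [/\ 1 >= x, x >= y & y > 1 - x]].

Definition Gamma1 : set (plane R) := triangle `\` Gamma0.

(* The map is only meaningful on the triangle = Gamma0 `|` Gamma1, which it
   sends into itself; the value outside the triangle is irrelevant. *)
Definition Smap z : plane R :=
  let x : R := z.1 in let y : R := z.2 in
  if z \in Gamma0 then (y / x, (1 - x) / x) else (x / (1 - y), y / (1 - y)).

Definition leb2 : {measure set (plane R) -> \bar R} :=
  (@lebesgue_measure R \x @lebesgue_measure R)%E.

(* (x y)^-1 is 0 by convention on the Lebesgue-null segment y = 0. *)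
Definition mu (A : set (plane R)) : \bar R :=
  (\int[leb2]_(z in A `&` triangle) ((z.1 * z.2 : R)^-1)%:E)%E.

Lemma measurable_triangle : measurable triangle.
Proof.
have mle (f g : plane R -> R) : measurable_fun setT f -> measurable_fun setT g ->
    measurable [set z | f z <= g z].
  move=> mf mg; have := measurable_fun_ler mf mg.
  by move=> /(_ measurableT [set true]); rewrite setTI; apply.
have -> : triangle = [set z : plane R | (z.1 : R) <= 1] `&`
    ([set z : plane R | (z.2 : R) <= z.1] `&` [set z : plane R | 0 <= (z.2 : R)]).
  by apply/seteqP; split=> z /=; [case|case=> ? []].
apply: measurableI; [|apply: measurableI]; apply: mle => //.
Qed.

Lemma measurable_invr : measurable_fun setT (GRing.inv : R -> R).
Proof.
have -> : [set: R] = [set 0] `|` [set x | x != 0].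
  by apply/seteqP; split=> // x _ /=; case: (eqVneq x 0) => [->|]; [left|right].
have o0 : open [set x : R | x != 0] by exact: open_neq.
apply/measurable_funU => //; first exact: open_measurable.
split; first exact: measurable_fun_set1.
apply: open_continuous_measurable_fun => // x; rewrite inE/= => x0.
exact: inv_continuous.
Qed.

Let mu_density_ge0 z : triangle z -> (0 <= ((z.1 * z.2 : R)^-1)%:E)%E.
Proof.
by case=> _ xy y0; rewrite lee_fin invr_ge0 mulr_ge0// (le_trans y0).
Qed.

Let measurable_mu_density :
  measurable_fun setT (fun z : plane R => ((z.1 * z.2 : R)^-1)%:E).
Proof.
apply/measurable_EFinP; apply: (measurableT_comp measurable_invr).
exact: measurable_funM.
Qed.

Let mu0 : mu set0 = 0%E.
Proof. by rewrite /mu set0I integral_set0. Qed.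

Let mu_ge0 A : (0 <= mu A)%E.
Proof. by apply: integral_ge0 => z [_ /mu_density_ge0]. Qed.

Let mu_sigma_additive : semi_sigma_additive mu.
Proof.
move=> F mF tF mUF; rewrite /mu setI_bigcupl.
have mFt i : measurable (F i `&` triangle).
  exact: measurableI (mF i) measurable_triangle.
rewrite ge0_integral_bigcup//.
- by apply: is_cvg_ereal_nneg_natsum_cond => n _ _; exact: mu_ge0.
- exact: measurable_funTS measurable_mu_density.
- by move=> z [i _ [_ /mu_density_ge0]].
- exact: trivIset_setIr tF.
Qed.

HB.instance Definition _ :=
  isMeasure.Build _ _ _ mu mu0 mu_ge0 mu_sigma_additive.

(* L^1(mu) and L^oo(mu) on the triangle, as sets of representatives.  As mu does
   not charge the complement of the triangle, ess_sup only sees the triangle. *)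
Definition L1mu (f : plane R -> R) : Prop :=
  mu.-integrable triangle (EFin \o f).

Definition Linfty_mu (g : plane R -> R) : Prop :=
  measurable_fun triangle g /\ (ess_sup mu (fun z => `|g z|%:E) < +oo)%E.

(* A choice of representatives for the dual operator L^1(mu) -> L^1(mu) of Smap. *)
Definition is_transfer_operator (T : (plane R -> R) -> (plane R -> R)) : Prop :=
  forall f, L1mu f ->
    L1mu (T f) /\
    forall g, Linfty_mu g ->
      \int[mu]_(z in triangle) (T f z * g z) =
      \int[mu]_(z in triangle) (f z * g (Smap z)).

(* a realises the pointwise dual ergodicity of Smap, with dual operator T. *)
Definition dual_ergodic_sequence
    (T : (plane R -> R) -> (plane R -> R)) (a : R^nat) : Prop :=
  (forall n, 0 < a n) /\
  forall f, L1mu f ->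
    {ae mu, forall z, triangle z ->
      (fun n : nat => (a n)^-1 * \sum_(0 <= k < n) iter k T f z) @ \oo -->
      \int[mu]_(w in triangle) f w}.

End triangle_map.

Arguments triangle {R}.
Arguments Smap {R} z.
Arguments leb2 {R}.
Arguments mu {R} A.

(* Main.v *)
Require Import Defs.
From mathcomp Require Import all_boot all_order all_algebra.
From mathcomp Require Import all_classical all_reals all_analysis.
From mathcomp Require Import measurable_realfun ess_sup_inf ring lra.
Import Order.TTheory GRing.Theory Num.Theory.
Import numFieldNormedType.Exports.
Local Open Scope classical_set_scope.
Local Open Scope ring_scope.

(** The second-moment method for the occupation times S_n f of f along the orbits. By
    duality the first moment of S_n f is the integral of f against the sums of the
    iterates of the dual operator, and the second moment is at most twice the
    convolution of these sums with the correlations of f; when (a_n) has index 1 the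
    convolution is asymptotically half of the squared first moment, so the variance
    of S_n f / a_n vanishes. Applied to the limit statement itself, Fatou's lemma
    shows that mu is subinvariant; a maximum principle then bounds the sums of the
    iterates of the indicator of a suitable set A by a constant times a_n on the
    whole space. Hence f |-> S_n f / a_n is bounded from L^1(mu) to L^1(mu|A)
    uniformly in n, which extends the convergence in measure from bounded functions
    to all of L^1(mu), and absolute continuity transfers it to Prob. *)

Set Implicit Arguments.
Unset Strict Implicit.
Unset Printing Implicit Defensive.

(** * Regular variation *)

(** The dual sums converge only almost everywhere, with no control uniform in the point, while every
    moment estimate needs a bound by a multiple of [a n]. The sets [tame K] build such a bound into
    their definition, for one fixed positive integrable [q]; they exhaust the space up to a null
    set, and duality passes the bound from [q] to every bounded function carried by [tame K]. A
    bound up to a constant settles the L^1 continuity but not the variance: there the second moment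
    must match the squared first moment exactly, so the sums for the indicator of [tame K] must be
    close to [mu (tame K)] times [a n] uniformly. Egorov's theorem gives this on a large part [B] of
    [tame K], and the functions treated directly are those vanishing off [B]. The factor 2 from
    pairs of times then cancels the factor 1/2 of the convolution. The explicit density serves only
    to produce [q] and to identify null sets: how [mu] behaves under the map is read off from the
    limit hypothesis rather than computed. *)

Section regular_variation.
Context (R : realType).
Implicit Types (a u : R^nat) (c : R).

Lemma truncn_mul_cvgny c : 0 < c ->
  (fun n : nat => Num.truncn (c * n%:R)) @ \oo --> \oo.
Proof.
move=> c0; apply/cvgnyPge => A; near=> n.
rewrite truncn_ge_nat ?mulr_ge0 ?(ltW c0)// mulrC -ler_pdivrMr//.
by near: n; exact: nbhs_infty_ger.
Unshelve. all: by end_near. Qed.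

Lemma sum_nondecreasing u : (forall n, 0 <= u n) ->
  nondecreasing_seq (fun n => \sum_(0 <= m < n) u m).
Proof. by move=> u0; apply/nondecreasing_seqP => n; rewrite big_nat_recr //= lerDl. Qed.

(** At the dilated index the ratio factors into a ratio of values of [a] and the given ratio taken
    at that index. The value [d = 0], needed for the first endpoint of the blocks below, is separate
    because regular variation speaks only of positive dilations. *)
Lemma regularly_varying_sum a u c d : (forall n, 0 < a n) ->
  regularly_varying a 1 ->
  (fun n => (\sum_(0 <= m < n) u m) / a n) @ \oo --> c -> 0 <= d ->
  (fun n : nat => (\sum_(0 <= m < Num.truncn (d * n%:R)) u m) / a n) @ \oo --> d * c.
Proof.
move=> a0 ra uac; rewrite le_eqVlt => /predU1P[<-|d0].
  under eq_fun do rewrite mul0r truncn0 big_geq// mul0r.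
  by rewrite mul0r; exact: cvg_cst.
have -> : (fun n : nat => (\sum_(0 <= m < Num.truncn (d * n%:R)) u m) / a n) =
  (fun n : nat => (a (Num.truncn (d * n%:R)) / a n) *
   ((\sum_(0 <= m < Num.truncn (d * n%:R)) u m) / a (Num.truncn (d * n%:R)))).
  apply/funext => n; rewrite [RHS]mulrC mulrA -(mulrA _ _ (a _)) mulVf ?mulr1//.
  by rewrite gt_eqF.
apply: cvgM; first by have := ra _ d0; rewrite powRr1 ?ltW.
exact: (cvg_comp _ _ (truncn_mul_cvgny d0) uac).
Qed.

(* If the nondecreasing partial sums converged, so would a, against the doubling
   ratio 2 given by the index 1. *)
Lemma regularly_varying_dvg a u c : (forall n, 0 < a n) -> (forall n, 0 <= u n) ->
  regularly_varying a 1 -> 0 < c ->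
  (fun n => (\sum_(0 <= m < n) u m) / a n) @ \oo --> c ->
  a n @[n --> \oo] --> +oo.
Proof.
move=> a0 u0 ra c0 uac.
pose U n := \sum_(0 <= m < n) u m.
have aE n : a n = U n / (U n / a n) \/ U n = 0.
  have [->|Un] := eqVneq (U n) 0; first by right.
  by left; rewrite invf_div mulrCA divff// mulr1.
have [cU|dU] := pselect (cvgn U).
  exfalso.
  have Un0 : \forall n \near \oo, 0 < U n.
    have : \forall n \near \oo, 0 < U n / a n by exact: (cvgr_gt _ uac).
    by apply: filterS => n; rewrite pmulr_lgt0// invr_gt0.
  have aL : a n @[n --> \oo] --> limn U / c.
    have : (fun n => U n / (U n / a n)) @ \oo --> limn U / c.
      by apply: cvgM => //; apply: cvgV => //; rewrite gt_eqF.
    apply: cvg_trans; apply: near_eq_cvg.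
    apply: filterS Un0 => n n0; case: (aE n) => [/esym//|nn].
    by move: n0; rewrite nn ltxx.
  have L0 : 0 < limn U.
    have [n Un] : exists n, 0 < U n.
      exact: filter_ex Un0.
    apply: (lt_le_trans Un).
    exact: (nondecreasing_cvgn_le (sum_nondecreasing u0) cU).
  have hU : (fun n : nat => U (Num.truncn (2%:R * n%:R : R))) @ \oo --> limn U.
    exact: (cvg_comp _ _ (truncn_mul_cvgny (ltr0n R 2)) cU).
  have ha : (fun n => (a n)^-1) @ \oo --> (limn U / c)^-1.
    by apply: cvgV => //; rewrite gt_eqF// divr_gt0.
  have h1 : (fun n : nat => U (Num.truncn (2%:R * n%:R : R)) / a n) @ \oo -->
    limn U / (limn U / c) by exact: cvgM hU ha.
  have : limn U / (limn U / c) = 2%:R * c.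
    exact: (cvg_unique _ h1 (regularly_varying_sum a0 ra uac (ler0n R 2))).
  by rewrite invf_div mulrCA divff ?gt_eqF//; move: c0; lra.
have Uoo : U n @[n --> \oo] --> +oo.
  exact: nondecreasing_dvgn_lt (sum_nondecreasing u0) dU.
apply/cvgryPge => A; near=> n.
have Un : (c + 1) * `|A| <= U n.
  by near: n; move/cvgryPge : Uoo; exact.
have : U n / a n < c + 1 by near: n; apply: (cvgr_lt _ uac); rewrite ltrDl.
rewrite ltr_pdivrMr// => /(le_lt_trans Un).
rewrite ltr_pM2l ?addr_gt0// => /ltW; apply: le_trans; exact: ler_norm.
Unshelve. all: by end_near. Qed.

Section blocks.
Context (u : R^nat) (u0 : forall n, 0 <= u n) (k : nat).
Let U n := \sum_(0 <= m < n) u m.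
Let N i n := Num.truncn (i%:R / k.+1%:R * n%:R : R).

Let UE : nondecreasing_seq U. Proof. exact: sum_nondecreasing. Qed.

Let N_nd i n : (N i n <= N i.+1 n)%N.
Proof. by rewrite le_truncn// ler_wpM2r// ler_wpM2r// ler_nat. Qed.

(** The complementary index would be [k.+1 - i]; one extra block absorbs the rounding of the two
    integer parts. This requires a block length of at least 1, hence [k < n]. *)
Let NN i n : (i <= k)%N -> (k < n)%N -> (n - N i n <= N (k.+2 - i) n)%N.
Proof.
move=> ik kn; rewrite leq_subLR -ltnS -(ltr_nat R) -(ltrD2r 1).
have h (x : R) : x < (Num.truncn x)%:R + 1 by rewrite natr1 truncnS_gt.
rewrite -natr1 natrD.
have := ltrD (h (i%:R / k.+1%:R * n%:R)) (h ((k.+2 - i)%:R / k.+1%:R * n%:R)).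
rewrite -/(N i n) -/(N (k.+2 - i) n) natrB; last by rewrite (leq_trans ik)// ltnW// ltnW.
have -> : i%:R / k.+1%:R * n%:R + (k.+2%:R - i%:R) / k.+1%:R * n%:R =
    n%:R + n%:R / k.+1%:R :> R.
  have : k.+1%:R != 0 :> R by rewrite pnatr_eq0.
  by rewrite -[k.+2%:R]natr1; set K := k.+1%:R => K0; field.
have : 1 <= n%:R / k.+1%:R :> R by rewrite ler_pdivlMr// mul1r ler_nat.
by set x := n%:R / _; lra.
Qed.

(** An upper Riemann-Stieltjes sum: for [m] in the block starting at [N j n], monotonicity of [U]
    bounds [U (n - m)] by its value at the left endpoint, and the [u m] of the block add up to an
    increment of [U]. *)
Lemma sum_convolution_le n : (k < n)%N ->
  \sum_(0 <= m < n) U (n - m) * u m <=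
  \sum_(0 <= i < k.+1) U (N (k.+2 - i) n) * (U (N i.+1 n) - U (N i n)).
Proof.
move=> kn.
have nE : n = N k.+1 n by rewrite /N divff// mul1r natrK.
rewrite [X in index_iota 0 X]nE.
suff H j : (j <= k.+1)%N -> \sum_(0 <= m < N j n) U (n - m) * u m <=
    \sum_(0 <= i < j) U (N (k.+2 - i) n) * (U (N i.+1 n) - U (N i n)) by exact: H.
elim: j => [_|j ih jk].
  by rewrite /N !mul0r truncn0 !big_geq.
rewrite (@big_cat_nat _ _ _ (N j n))//= big_nat_recr//=.
apply: lerD; first exact/ih/ltnW.
have -> : U (N j.+1 n) - U (N j n) = \sum_(N j n <= m < N j.+1 n) u m.
  by rewrite /U (@big_cat_nat _ _ _ (N j n) 0 (N j.+1 n))//= addrAC subrr add0r.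
rewrite mulr_sumr; apply: ler_sum_nat => m /andP[jm _].
by rewrite ler_wpM2r// UE// (leq_trans _ (NN _ _))// leq_sub2l.
Qed.

End blocks.


Lemma sum_subr_nat (B : R) K :
  \sum_(0 <= i < K) (B - i%:R) = K%:R * B - K%:R * (K%:R - 1) / 2%:R.
Proof.
elim: K => [|K ih]; first by rewrite big_geq// !mul0r subr0.
by rewrite big_nat_recr//= ih -natr1; field.
Qed.

(* With [u] normalised like the density of [a], the sum is a Riemann sum for the
   integral of [1 - t] over [0, 1], whence the factor 1/2. *)
Lemma regularly_varying_convolution a u c eps : (forall n, 0 < a n) ->
  (forall n, 0 <= u n) -> regularly_varying a 1 -> 0 < c ->
  (fun n => (\sum_(0 <= m < n) u m) / a n) @ \oo --> c -> 0 < eps ->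
  \forall n \near \oo,
    \sum_(0 <= m < n) a (n - m)%N * u m <= (c / 2 + eps) * a n ^+ 2.
Proof.
move=> a0 u0 ra c0 uac eps0.
pose U n := \sum_(0 <= m < n) u m.
have U0 n : 0 <= U n by apply: sumr_ge0.
have aoo := regularly_varying_dvg a0 u0 ra c0 uac.
(* With [K = k.+1], the Riemann sum below exceeds [c / 2] by [(4 K + 3) c / (2 K^2)], which is at
   most [7 c / (2 K)]; this choice makes it smaller than [eps]. *)
pose k := Num.truncn (7 * c / (2 * eps)).
have K0 : 0 < k.+1%:R :> R by rewrite ltr0n.
have Kc : 7 * c < k.+1%:R * (2 * eps).
  by rewrite -ltr_pdivrMr ?mulr_gt0// truncnS_gt.
pose N i n := Num.truncn (i%:R / k.+1%:R * n%:R : R).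
(* The sequence [a] need not be monotone, so it is replaced in the convolution by [U], asymptotic to
   [c * a]. The factor [s] slightly exceeds [1 / c], and the constant [C] below takes care of the
   finitely many early indices. *)
pose s : R := (1 + 1 / k.+1%:R) / c.
have s0 : 0 < s by rewrite divr_gt0// addr_gt0// divr_gt0.
have [C C0 aC] : exists2 C, 0 <= C & forall n, a n <= s * U n + C.
  have : \forall n \near \oo, s^-1 < U n / a n.
    apply: (cvgr_gt _ uac); rewrite /s invf_div ltr_pdivrMr//.
    by rewrite mulrDr mulr1 ltrDl mulr_gt0// divr_gt0.
  move=> [n0 _ n0P]; exists (\sum_(0 <= i < n0) a i).
    by apply: sumr_ge0 => i _; exact: ltW.
  move=> n; have [nn0|n0n] := ltnP n n0.
    rewrite -[leLHS]add0r lerD//; first by rewrite mulr_ge0// ltW.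
    rewrite (bigD1_seq n)//= ?mem_index_iota ?iota_uniq//.
    by rewrite lerDl sumr_ge0// => i _; exact: ltW.
  have := n0P n n0n; rewrite /= ltr_pdivlMr// ltr_pdivrMl// => /ltW/le_trans; apply.
  by rewrite lerDl; apply: sumr_ge0 => i _; exact: ltW.
pose g n := s * (\sum_(0 <= i < k.+1) (U (N (k.+2 - i)%N n) / a n) *
  (U (N i.+1 n) / a n - U (N i n) / a n)) + C * (U n / a n) * (a n)^-1.
have cvU i : (fun n => U (N i n) / a n) @ \oo --> i%:R / k.+1%:R * c.
  by apply: regularly_varying_sum => //; rewrite divr_ge0.
have cg : g n @[n --> \oo] --> s * (\sum_(0 <= i < k.+1)
   ((k.+2 - i)%N%:R / k.+1%:R * c) * (i.+1%:R / k.+1%:R * c - i%:R / k.+1%:R * c))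
   + C * c * 0.
  apply: cvgD.
    apply: cvgMr; apply: cvg_big => [|i _]; first exact: add_continuous.
    apply: cvgM; first exact: cvU.
    by apply: cvgB; exact: cvU.
  apply: cvgM; first exact: cvgMr.
  by apply/gtr0_cvgV0; [exact: nearW|exact: aoo].
have gle n : (k < n)%N -> (\sum_(0 <= m < n) a (n - m)%N * u m) / a n ^+ 2 <= g n.
  move=> kn; rewrite ler_pdivrMr ?exprn_gt0//.
  have -> : g n * a n ^+ 2 = s * (\sum_(0 <= i < k.+1) U (N (k.+2 - i)%N n) *
     (U (N i.+1 n) - U (N i n))) + C * U n.
    rewrite /g mulrDl -mulrA mulr_suml; congr (s * _ + _).
      apply: eq_bigr => i _; field; exact: lt0r_neq0.
    by field; exact: lt0r_neq0.
  apply: (@le_trans _ _ (s * (\sum_(0 <= m < n) U (n - m)%N * u m) + C * U n)).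
    rewrite [_ * U n]mulr_sumr mulr_sumr -big_split/=; apply: ler_sum => m _.
    by rewrite mulrA -mulrDl ler_wpM2r.
  by rewrite lerD2r ler_pM2l//; exact: sum_convolution_le.
have limE : s * (\sum_(0 <= i < k.+1)
   ((k.+2 - i)%N%:R / k.+1%:R * c) * (i.+1%:R / k.+1%:R * c - i%:R / k.+1%:R * c))
   + C * c * 0 < c / 2 + eps.
  rewrite mulr0 addr0.
  rewrite (_ : \sum_(0 <= i < k.+1) _ =
      (c / k.+1%:R) ^+ 2 * \sum_(0 <= i < k.+1) (k.+2%:R - i%:R)); last first.
    rewrite mulr_sumr; apply: eq_big_nat => i /andP[_ ik].
    by rewrite natrB ?(leq_trans (ltnW ik))// -[i.+1%:R]natr1; field; exact: lt0r_neq0.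
  rewrite sum_subr_nat /s -[k.+2%:R]natr1.
  move: K0 Kc; set K := k.+1%:R => K0 Kc.
  have -> : (1 + 1 / K) / c * ((c / K) ^+ 2 * (K * (K + 1) - K * (K - 1) / 2)) =
     c / 2 + (4 * K + 3) * c / (2 * K ^+ 2).
    by field; rewrite !lt0r_neq0.
  rewrite ltrD2l ltr_pdivrMr ?mulr_gt0 ?exprn_gt0//.
  have K1 : 1 <= K by rewrite ler1n.
  have : K * (7 * c) < K * (K * (2 * eps)) by rewrite ltr_pM2l.
  have : 0 <= (K - 1) * c by rewrite mulr_ge0 ?subr_ge0// ltW.
  rewrite mulrA; nra.
near=> n.
rewrite -ler_pdivrMr ?exprn_gt0//.
apply: (@le_trans _ _ (g n)); first by apply: gle; near: n; exact: nbhs_infty_gt.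
by near: n; exact: (cvgr_le _ cg).
Unshelve. all: by end_near. Qed.

End regular_variation.

Lemma cvg_min_limit (R : realType) (u : R^nat) c : u n @[n --> \oo] --> c ->
  Num.min (u n) c @[n --> \oo] --> c.
Proof.
move=> uc; under eq_fun do rewrite minr_absE.
suff : (u n + c - `|u n - c|) / 2 @[n --> \oo] --> (c + c - `|c - c|) / 2.
  by rewrite subrr normr0 subr0 (_ : (c + c) / 2 = c)//; field.
apply: cvgMl; apply: cvgB; first by apply: cvgD => //; exact: cvg_cst.
by apply: cvg_norm; apply: cvgB => //; exact: cvg_cst.
Qed.

(** Pairs of times are grouped by their lag [m]. Off-diagonal products occur twice in the square;
    counting the diagonal twice as well gives an inequality. The inner range [n - m] is what later
    produces a convolution. *)
Lemma sqr_sum_le (R : realType) (x : R^nat) n : (forall k, 0 <= x k) ->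
  (\sum_(0 <= k < n) x k) ^+ 2 <=
  2 * \sum_(0 <= m < n) \sum_(0 <= j < n - m) x j * x (j + m)%N.
Proof.
move=> x0; elim: n => [|n ih]; first by rewrite !big_geq// expr0n mulr0.
have -> : \sum_(0 <= m < n.+1) \sum_(0 <= j < n.+1 - m) x j * x (j + m)%N =
    \sum_(0 <= m < n) (\sum_(0 <= j < n - m) x j * x (j + m)%N) +
    (\sum_(0 <= m < n.+1) x m) * x n.
  rewrite (eq_big_nat _ _ (F2 := fun m => \sum_(0 <= j < n - m) x j * x (j + m)%N +
      x (n - m)%N * x n)); last first.
    by move=> m /andP[_]; rewrite ltnS => mn; rewrite subSn// big_nat_recr//= subnK.
  rewrite big_split/= [in X in X + _]big_nat_recr//= subnn [in X in _ + X + _]big_geq// addr0.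
  congr (_ + _); rewrite big_nat_rev/= add0n mulr_suml; apply: eq_big_nat => m /andP[_ mn].
  by rewrite subSS subKn.
rewrite big_nat_recr//= mulrDr sqrrD -addrA lerD//.
by have := sqr_ge0 (x n); rewrite -mulr_natl; lra.
Qed.

Lemma normr_indic_le1 (T : Type) (R : realType) (E : set T) z : `|\1_E z : R| <= 1.
Proof. by rewrite indicE normr_nat lern1 leq_b1. Qed.

Lemma cvge0P (R : realType) (u : (\bar R)^nat) : (forall n, (0 <= u n)%E) ->
  (forall e : R, 0 < e -> \forall n \near \oo, (u n <= e%:E)%E) -> u @ \oo --> 0%E.
Proof.
move=> u0 ue; apply/fine_cvgP; split.
  by apply: filterS (ue 1 ltr01) => n un; rewrite ge0_fin_numE// (le_lt_trans un)// ltry.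
apply/cvgrPdist_le => e e0; apply: filterS (ue e e0) => n un.
rewrite sub0r normrN ger0_norm ?fine_ge0// -lee_fin fineK//.
by rewrite ge0_fin_numE// (le_lt_trans un)// ltry.
Qed.

Lemma cvge0_le (R : realType) (u : (\bar R)^nat) (e : R) :
  u @ \oo --> 0%E -> 0 < e -> \forall n \near \oo, (u n <= e%:E)%E.
Proof.
move=> /fine_cvgP[fin cfin] e0; near=> n.
rewrite -[leLHS]fineK; last by near: n; exact: fin.
by rewrite lee_fin; near: n; exact: (cvgr_le _ cfin _ e0).
Unshelve. all: by end_near. Qed.

(** * Real-valued integrals *)

Section real_integral.
Context d (X : measurableType d) (R : realType) (mu : {measure set X -> \bar R}).
Implicit Types (f g h : X -> R) (E A : set X).
Local Notation L1 f := (mu.-integrable setT (EFin \o f)).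

Lemma measurable_le_set f g : measurable_fun setT f -> measurable_fun setT g ->
  measurable [set z | f z <= g z].
Proof.
move=> mf mg; have := measurable_fun_ler mf mg.
by move=> /(_ measurableT [set true]); rewrite setTI; apply.
Qed.

Lemma measurable_gt_set f (e : R) : measurable_fun setT f -> measurable [set z | e < f z].
Proof.
move=> mf; rewrite (_ : [set z | _] = ~` [set z | f z <= e]); last first.
  by apply/seteqP; split=> z /=; [move=> h; apply/negP|move/negP]; rewrite -ltNge.
by apply: measurableC; exact: measurable_le_set.
Qed.

Lemma integrable_measurable f : L1 f -> measurable_fun setT f.
Proof. by move=> /integrableP[/measurable_EFinP]. Qed.

Lemma integrable_le f g : measurable_fun setT f -> L1 g ->
  (forall z, `|f z| <= g z) -> L1 f.
Proof.
move=> mf ig fg; apply: (le_integrable _ _ _ ig) => //; first exact/measurable_EFinP.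
by move=> z _; rewrite lee_fin (le_trans (fg z))// ler_norm.
Qed.

Lemma integrable_scale r f : L1 f -> L1 (fun z => r * f z).
Proof. by move=> /(integrableZl measurableT r); apply: eq_integrable. Qed.

Lemma integrable_add f g : L1 f -> L1 g -> L1 (fun z => f z + g z).
Proof. by move=> If Ig; have := integrableD measurableT If Ig; apply: eq_integrable. Qed.

Lemma integrable_sub f g : L1 f -> L1 g -> L1 (fun z => f z - g z).
Proof. by move=> If Ig; have := integrableB measurableT If Ig; apply: eq_integrable. Qed.

Lemma integrable_sum_nat (t : nat -> X -> R) m n : (forall k, L1 (t k)) ->
  L1 (fun z => \sum_(m <= k < n) t k z).
Proof.
move=> It; have := integrable_sum measurableT (index_iota m n) (P := xpredT) (fun k _ => It k).
by apply: eq_integrable => // z _; rewrite /= sumEFin.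
Qed.

Lemma integrable_mul_bounded f h M : L1 f -> measurable_fun setT h ->
  (forall z, `|h z| <= M) -> L1 (fun z => f z * h z).
Proof.
move=> If mh hM.
apply: (@integrable_le _ (fun z => M * `|f z|)) => [||z].
- by apply: measurable_funM => //; exact: integrable_measurable.
- exact: (integrable_scale M (integrable_norm If)).
- by rewrite normrM mulrC /= ler_wpM2r.
Qed.

Lemma integrable_indic_lty A : measurable A -> (mu A < +oo)%E -> L1 (\1_A : X -> R).
Proof.
move=> mA Afin; apply/integrableP; split; first exact/measurable_EFinP.
by under eq_integral do rewrite /= ger0_norm//; rewrite integral_indic// setIT.
Qed.

Lemma Rintegral_sum_nat (t : nat -> X -> R) m n : (forall k, L1 (t k)) ->
  \int[mu]_x (\sum_(m <= k < n) t k x) = \sum_(m <= k < n) \int[mu]_x t k x.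
Proof.
move=> It; rewrite /Rintegral.
under eq_integral do rewrite -sumEFin.
rewrite (integral_sum measurableT)//.
rewrite sum_fine// => k _; exact: (integrable_fin_num measurableT (It k)).
Qed.

Lemma Rintegral_indic E : measurable E ->
  \int[mu]_x (\1_E x) = fine (mu E).
Proof. by move=> mE; rewrite /Rintegral integral_indic// setIT. Qed.

Lemma EFin_Rintegral f : L1 f -> (\int[mu]_x f x)%:E = (\int[mu]_x (f x)%:E)%E.
Proof. by move=> If; rewrite fineK//; exact: (integrable_fin_num measurableT If). Qed.

Lemma Rintegral_dominated (F : nat -> X -> R) f g :
  (forall n, L1 (F n)) -> measurable_fun setT f ->
  {ae mu, forall z, F ^~ z @ \oo --> f z} -> L1 g ->
  {ae mu, forall z, forall n, `|F n z| <= g z} ->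
  L1 f /\ (fun n => \int[mu]_x F n x) @ \oo --> \int[mu]_x f x.
Proof.
move=> IF mf cF Ig Fg.
have [] := @dominated_convergence _ _ _ mu setT measurableT
  (fun n => EFin \o F n) (EFin \o f) (EFin \o g).
- by move=> n; apply/measurable_EFinP; exact: integrable_measurable.
- exact/measurable_EFinP.
- by apply: filterS cF => z cz _; apply/fine_cvgP; split; [exact: nearW|exact: cz].
- exact: Ig.
- by apply: filterS Fg => z cz n _; rewrite lee_fin.
move=> If _ cI; split=> //.
by apply: (fine_cvg); rewrite EFin_Rintegral.
Qed.

(** On the set [E] where [f] is negative, the product of [f] with the indicator is nowhere positive
    yet has nonnegative integral, hence vanishes almost everywhere. This turns inequalities between
    pairings into pointwise ones. *)
Lemma Rintegral_ae_ge0 f : L1 f ->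
  (forall E, measurable E -> 0 <= \int[mu]_x (f x * \1_E x)) ->
  {ae mu, forall z, 0 <= f z}.
Proof.
move=> If If0; have mf := integrable_measurable If.
pose E := [set z | f z < 0].
have mE : measurable E.
  rewrite (_ : E = ~` [set z | 0 <= f z]); last first.
    by apply/seteqP; split=> z /=; [move=> h; apply/negP|move/negP]; rewrite -ltNge.
  by apply: measurableC; exact: measurable_le_set.
pose h z := f z * \1_E z.
have h0 z : h z <= 0.
  rewrite /h indicE; have [/set_mem/ltW fz|_] := boolP (z \in E).
    by rewrite mulr1.
  by rewrite mulr0.
have Ih : L1 h.
  apply: (@integrable_mul_bounded _ _ 1) => //.
  by move=> z; rewrite indicE; case: (_ \in _); rewrite ?normr1// normr0.
have : (\int[mu]_x `|(h x)%:E| = 0)%E.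
  rewrite (eq_integral (fun z => (-1 * h z)%:E)); last first.
    by move=> z _; rewrite /= ler0_norm// mulN1r.
  rewrite -(EFin_Rintegral (integrable_scale (-1) Ih)) RintegralZl//; congr EFin.
  apply/eqP; rewrite mulN1r oppr_eq0 eq_le If0// andbT.
  have := le_Rintegral measurableT Ih (integrable0 mu setT) (fun x _ => h0 x).
  by rewrite Rintegral_cst// mul0r.
move=> /ae_eq_integral_abs => /(_ measurableT (measurable_int _ Ih)).
apply: filterS => z /(_ Logic.I) [] hz; rewrite leNgt; apply/negP => fz.
by move: hz; rewrite /h indicE mem_set// mulr1 => fz0; rewrite fz0 ltxx in fz.
Qed.

(** Markov's inequality; the finiteness of [mu E] comes out of the integrability of [h]. *)
Lemma measure_le_Rintegral E c h : measurable E -> 0 < c -> L1 h ->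
  (forall z, 0 <= h z) -> (forall z, E z -> c <= h z) ->
  (mu E <= (\int[mu]_x h x / c)%:E)%E.
Proof.
move=> mE c0 Ih h0 Eh.
have Eh1 z : \1_E z <= c^-1 * h z.
  rewrite indicE; have [/set_mem/Eh|_] := boolP (z \in E); last first.
    by rewrite mulr_ge0 ?invr_ge0 ?(ltW c0).
  by move=> cz; rewrite mulrC ler_pdivlMr// mul1r.
have IE : L1 (\1_E : X -> R).
  apply: (@integrable_le _ (fun z => c^-1 * h z)) => //; first exact: integrable_scale.
  by move=> z; rewrite ger0_norm.
have -> : mu E = (\int[mu]_z (\1_E z)%:E)%E by rewrite integral_indic// setIT.
rewrite -EFin_Rintegral// lee_fin.
rewrite mulrC -RintegralZl//; apply: le_Rintegral => //; exact: integrable_scale.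
Qed.

End real_integral.

Section exhaustion.
Context d (X : measurableType d) (R : realType) (nu : {measure set X -> \bar R}).

Lemma exhaustion_cvg (A : (set X)^nat) F : (forall K, measurable (A K)) ->
  nondecreasing_seq A -> nu (~` \bigcup_K A K) = 0%E -> measurable F ->
  (fun K => nu (F `&` A K)) @ \oo --> nu F.
Proof.
move=> mA ndA nuA mF.
have mU : measurable (\bigcup_K A K) by exact: bigcupT_measurable.
rewrite (_ : nu F = nu (\bigcup_K (F `&` A K))).
  apply: nondecreasing_cvg_mu.
  - by move=> K; exact: measurableI.
  - by apply: bigcupT_measurable => K; exact: measurableI.
  - by move=> m n mn; apply/subsetPset; apply: setIS; apply/subsetPset/ndA.
rewrite -setI_bigcupr.
rewrite -[in LHS](setIT F) -(setUv (\bigcup_K A K)) setIUr measureU//.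
- rewrite [X in (_ + X)%E](_ : _ = 0%E) ?adde0//.
  apply: subset_measure0 nuA; last by move=> z [].
  + by apply: measurableI => //; exact: measurableC.
  + exact: measurableC.
- exact: measurableI.
- by apply: measurableI => //; exact: measurableC.
- by rewrite setIACA setICr setI0.
Qed.

End exhaustion.

(** * Iterates of the dual operator *)

Section dual_sequences.
Context d (X : measurableType d) (R : realType) (mu : {measure set X -> \bar R}).
Context (S : X -> X) (mS : measurable_fun setT S) (a : R^nat).
Implicit Types (f g h p : X -> R) (t : nat -> X -> R) (E A : set X).
Local Notation L1 f := (mu.-integrable setT (EFin \o f)).

Definition orbit_sum h n z : R := \sum_(0 <= k < n) h (iter k S z).

Definition partial_sum t n z : R := \sum_(0 <= k < n) t k z.

(* [t k] represents the [k]-th iterate of the transfer operator applied to [p]. *)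
Record dual_iterates p t : Prop := DualIterates {
  dual_integrable : forall k, L1 (t k) ;
  dual_pairing : forall k h M, measurable_fun setT h -> (forall z, `|h z| <= M) ->
    \int[mu]_z (t k z * h z) = \int[mu]_z (p z * h (iter k S z)) ;
  dual_cvg : {ae mu, forall z,
    (fun n => (a n)^-1 * partial_sum t n z) @ \oo --> \int[mu]_z p z} }.

Lemma measurable_iter k : measurable_fun setT (iter k S).
Proof. elim: k => [|k ih]; first exact: measurable_id.
exact: (measurableT_comp mS ih). Qed.

Lemma measurable_orbit h k : measurable_fun setT h ->
  measurable_fun setT (fun z => h (iter k S z)).
Proof. by move=> mh; apply: (measurableT_comp mh (measurable_iter k)). Qed.

Lemma measurable_orbit_sum h n : measurable_fun setT h ->
  measurable_fun setT (orbit_sum h n).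
Proof. by move=> mh; apply: measurable_sum => k; exact: measurable_orbit. Qed.

Lemma measurable_orbit_deviation h n (c e : R) : measurable_fun setT h ->
  measurable [set z | e < `|orbit_sum h n z / a n - c|].
Proof.
move=> mh; apply: measurable_gt_set; apply: measurableT_comp => //.
apply: measurable_funB => //; apply: measurable_funM => //.
exact: measurable_orbit_sum.
Qed.

Lemma orbit_sum_le h n M : (forall z, `|h z| <= M) ->
  forall z, `|orbit_sum h n z| <= n%:R * M.
Proof.
move=> hM z; rewrite (le_trans (ler_norm_sum _ _ _))//.
rewrite (le_trans (ler_sum _ (fun k _ => hM _)))//.
by rewrite sumr_const_nat subn0 mulr_natl.
Qed.

Lemma partial_sum_pairing p t h n M : L1 p -> dual_iterates p t ->
  measurable_fun setT h -> (forall z, `|h z| <= M) ->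
  \int[mu]_z (partial_sum t n z * h z) = \int[mu]_z (p z * orbit_sum h n z).
Proof.
move=> Ip [It tp _] mh hM.
under eq_Rintegral do rewrite mulr_suml.
under [RHS]eq_Rintegral do rewrite mulr_sumr.
rewrite !Rintegral_sum_nat.
- by apply: eq_bigr => k _; exact: tp hM.
- move=> k; apply: (integrable_mul_bounded (M := M)) => //.
  exact: measurable_orbit.
- by move=> k; exact: (integrable_mul_bounded (M := M)).
Qed.

(** Pairing with indicators shows the iterates to be nonnegative almost everywhere. Truncating them
    at 0 alters them on a null set only, which affects neither the pairings nor the almost
    everywhere limit. *)
Lemma dual_iterates_ge0 p t : L1 p -> (forall z, 0 <= p z) -> dual_iterates p t ->
  exists2 t', dual_iterates p t' & forall k z, 0 <= t' k z.
Proof.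
move=> Ip p0 [It tp ct].
have t0 : {ae mu, forall z, forall k, 0 <= t k z}.
  apply/ae_foralln => k; apply: Rintegral_ae_ge0 => // E mE.
  rewrite (@tp _ _ 1)//; last exact: normr_indic_le1.
  by apply: Rintegral_ge0 => z _; rewrite mulr_ge0.
exists (fun k z => Num.max (t k z) 0); last by move=> k z; rewrite le_max lexx orbT.
have mt k : measurable_fun setT (t k) by exact: integrable_measurable (It k).
have mt' k : measurable_fun setT (fun z => Num.max (t k z) 0).
  exact: measurable_maxr.
split.
- move=> k; apply: (@integrable_le _ _ _ _ _ (fun z => `|t k z|)) => //.
    exact: (integrable_norm (It k)).
  by move=> z; rewrite ger0_norm ?le_max ?lexx ?orbT// ge_max ler_norm normr_ge0.
- move=> k h M mh hM; rewrite -(tp k h M)// /Rintegral; congr fine.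
  apply: ae_eq_integral => //.
  + by apply/measurable_EFinP; exact: measurable_funM.
  + by apply/measurable_EFinP; exact: measurable_funM.
  + by apply: filterS t0 => z tz _; rewrite max_l.
- apply: filterS2 t0 ct => z tz; apply: cvg_trans; apply: near_eq_cvg.
  apply: nearW => n; rewrite /partial_sum; congr (_ * _).
  by apply: eq_bigr => k _; rewrite max_l.
Qed.

End dual_sequences.

(** * Subinvariance, maximum principle and second moment *)

Section weak_law.
Context d (X : measurableType d) (R : realType) (mu : {measure set X -> \bar R}).
Context (S : X -> X) (mS : measurable_fun setT S) (a : R^nat).
Implicit Types (f g h p : X -> R) (t : nat -> X -> R) (E A : set X).
Local Notation L1 f := (mu.-integrable setT (EFin \o f)).
Context (a0 : forall n, 0 < a n).
Context (q : X -> R) (q0 : forall z, 0 < q z) (Iq : L1 q).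
Context (tq : nat -> X -> R) (dq : dual_iterates mu S a q tq).
Context (tq0 : forall k z, 0 <= tq k z).

(** The first condition dominates the indicator of the set by a multiple of [q], the second bounds
    the dual sums of [q] on the set for all [n] at once; each contributes one factor of
    [tame_cst]. *)
Definition tame K : set X :=
  [set z | 1 <= K.+1%:R * q z /\ forall n, partial_sum tq n z <= K.+1%:R * a n].

Let mq : measurable_fun setT q. Proof. exact: integrable_measurable Iq. Qed.

Lemma measurable_partial_sum t n : (forall k, measurable_fun setT (t k)) ->
  measurable_fun setT (partial_sum t n : X -> R).
Proof. by move=> mt; exact: measurable_sum. Qed.

Lemma measurable_tame K : measurable (tame K).
Proof.
rewrite (_ : tame K = [set z | 1 <= K.+1%:R * q z] `&`
    \bigcap_n [set z | partial_sum tq n z <= K.+1%:R * a n]); last first.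
  by apply/seteqP; split=> z [? h]; split=> // n; [move=> _; exact: h|exact: h].
apply: measurableI.
  by apply: measurable_le_set => //; exact: measurable_funM.
apply: bigcapT_measurable => n; apply: measurable_le_set => //.
apply: measurable_partial_sum => k; apply: (@integrable_measurable _ _ _ mu).
exact: (dual_integrable dq).
Qed.
Hint Resolve measurable_tame : core.

Lemma indic_tame_le K z : \1_(tame K) z <= K.+1%:R * q z.
Proof.
rewrite indicE; have [/set_mem[]//|_] := boolP (z \in tame K).
by rewrite mulr_ge0// ltW.
Qed.

Lemma integrable_indic_tame K : L1 (\1_(tame K) : X -> R).
Proof.
apply: (@integrable_le _ _ _ _ _ (fun z => K.+1%:R * q z)) => //.
  exact: integrable_scale.
by move=> z; rewrite ger0_norm// indic_tame_le.
Qed.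

Lemma tame_lty K : (mu (tame K) < +oo)%E.
Proof.
have /integrableP[_] := integrable_indic_tame K.
under eq_integral do rewrite /= ger0_norm//.
by rewrite integral_indic// setIT.
Qed.

Lemma tame_nd : nondecreasing_seq tame.
Proof.
apply/nondecreasing_seqP => K; apply/subsetPset => z [qz wz].
have KK : K.+1%:R <= K.+2%:R :> R by rewrite ler_nat.
split=> [|n]; first by rewrite (le_trans qz)// ler_wpM2r// ltW.
by rewrite (le_trans (wz n))// ler_wpM2r// ltW.
Qed.

Lemma tame_conull : mu (~` \bigcup_K tame K) = 0%E.
Proof.
apply/negligibleP; first by apply: measurableC; exact: bigcupT_measurable.
apply: negligibleS (dual_cvg dq) => z /= nz /= cz; apply: nz.
have /cvg_seq_bounded [M [_ hM]] : cvgn (fun n => (a n)^-1 * partial_sum tq n z).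
  by apply/cvg_ex; exists (\int[mu]_z q z).
(* Boundedness of the convergent sequence is available for every bound strictly above [M], hence
   [M + 1]; the other entry is what positivity of [q z] requires. *)
pose r := Num.max (q z)^-1 (M + 1).
exists (Num.truncn r) => //; have rK : r <= (Num.truncn r).+1%:R by rewrite ltW// truncnS_gt.
split.
  rewrite -ler_pdivrMr// mul1r (le_trans _ rK)// /r le_max lexx//.
move=> n; rewrite -ler_pdivrMr// mulrC (le_trans (ler_norm _))//.
rewrite (le_trans _ rK)// le_max; apply/orP; right.
by apply: hM => //; rewrite ltrDl.
Qed.

Lemma tame_cvg F : measurable F -> (fun K => mu (F `&` tame K)) @ \oo --> mu F.
Proof. by apply: exhaustion_cvg => //; [exact: tame_nd|exact: tame_conull]. Qed.

Definition tame_cst K : R := K.+1%:R * K.+1%:R.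

Let mindic E : measurable E -> measurable_fun setT (\1_E : X -> R).
Proof. by move=> mE; exact: measurable_indic. Qed.

Let indic1 E z : `|\1_E z : R| <= 1. Proof. exact: normr_indic_le1. Qed.

Lemma integrable_indic_sub K E : measurable E -> E `<=` tame K -> L1 (\1_E : X -> R).
Proof.
move=> mE EK; apply: integrable_indic_lty => //.
by apply: le_lt_trans (tame_lty K); rewrite le_measure ?inE.
Qed.

(** The indicator of [tame K] is at most [K.+1 * q]; duality moves the orbit sum onto [q], and on
    [E] the dual sums of [q] are at most [K.+1 * a n]. *)
Lemma tame_visits_le K E n : measurable E -> E `<=` tame K ->
  \int[mu]_z (\1_(tame K) z * orbit_sum S \1_E n z) <=
  tame_cst K * a n * \int[mu]_z \1_E z.
Proof.
move=> mE EK; have mo := measurable_orbit_sum mS n (mindic mE).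
have bo := orbit_sum_le S n (indic1 E).
have Iqo : L1 (fun z => q z * orbit_sum S \1_E n z) by exact: integrable_mul_bounded bo.
apply: (@le_trans _ _ (K.+1%:R * \int[mu]_z (q z * orbit_sum S \1_E n z))).
  rewrite -RintegralZl//; apply: le_Rintegral => //.
  - exact: (integrable_mul_bounded (integrable_indic_tame K) mo bo).
  - exact: integrable_scale.
  - move=> z _; rewrite mulrA ler_wpM2r ?indic_tame_le//.
    by apply: sumr_ge0.
rewrite -(partial_sum_pairing mS n Iq dq (mindic mE) (indic1 E)).
rewrite /tame_cst -!mulrA ler_pM2l// mulrA -RintegralZl//; last exact: integrable_indic_sub EK.
apply: le_Rintegral => //.
- apply: (integrable_mul_bounded (M := 1)) => //.
  exact: integrable_sum_nat (dual_integrable dq).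
- by apply: integrable_scale; exact: integrable_indic_sub EK.
move=> z _; rewrite indicE; have [/set_mem/EK[_ h]|_] := boolP (z \in E).
  by rewrite !mulr1 h.
by rewrite !mulr0.
Qed.

Context (pde : forall p, L1 p -> exists t, dual_iterates mu S a p t).

(** * First moment of orbit sums for bounded functions carried by a tame set *)

Definition tame_fun K (M : R) f := [/\ measurable_fun setT f, forall z, 0 <= f z &
  forall z, f z <= M * \1_(tame K) z].

Lemma tame_fun_bounded K M f : tame_fun K M f -> forall z, `|f z| <= `|M|.
Proof.
move=> [_ f0 fM] z; rewrite ger0_norm// (le_trans (fM z))// (le_trans (ler_norm _))//.
by rewrite normrM ler_piMr// indic1.
Qed.

Lemma integrable_tame_fun K M f : tame_fun K M f -> L1 f.
Proof.
move=> [mf f0 fM]; apply: (@integrable_le _ _ _ _ _ (fun z => M * \1_(tame K) z)) => //.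
  by apply: integrable_scale; exact: integrable_indic_tame.
by move=> z; rewrite ger0_norm.
Qed.

Lemma tame_fun_notin K M f z : tame_fun K M f -> ~ tame K z -> f z = 0.
Proof.
move=> [mf f0 fM] nz; apply/eqP; rewrite eq_le f0 andbT (le_trans (fM z))//.
by rewrite indicE memNset// mulr0.
Qed.

(** Tested against every set [tame K] intersected with [E], the integral bound [tame_visits_le]
    becomes a pointwise bound by [Rintegral_ae_ge0]. *)
Lemma ae_partial_sum_le K M f t n : tame_fun K M f -> dual_iterates mu S a f t ->
  {ae mu, forall z, tame K z -> partial_sum t n z <= M * tame_cst K * a n}.
Proof.
move=> tf df; have If := integrable_tame_fun tf; have [mf f0 fM] := tf.
(* No sign is imposed on [M]; a negative one forces [tame K] to be empty. *)
have M0 : 0 <= M \/ forall z, ~ tame K z.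
  have [|M0] := leP 0 M; [by left|right => z Az].
  have := le_trans (f0 z) (fM z).
  by rewrite indicE mem_set// mulr1 leNgt M0.
case: M0 => [M0|nA]; last by apply: aeW => z /nA.
pose c := M * tame_cst K * a n.
have Ips : L1 (partial_sum t n) by exact: integrable_sum_nat (dual_integrable df).
have I1 E : measurable E -> L1 (\1_(tame K `&` E) : X -> R).
  by move=> mE; apply: (@integrable_indic_sub K); [exact: measurableI|exact: subIsetl].
have Ic E : measurable E -> L1 (fun z => partial_sum t n z * \1_(tame K `&` E) z).
  move=> mE; apply: (integrable_mul_bounded (M := 1)) => //.
  by apply: mindic; exact: measurableI.
have : {ae mu, forall z, 0 <= c * \1_(tame K) z - partial_sum t n z * \1_(tame K) z}.
  apply: Rintegral_ae_ge0.
    apply: integrable_sub.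
      by apply: integrable_scale; exact: integrable_indic_tame.
    by have := Ic setT measurableT; rewrite setIT.
  move=> E mE.
  rewrite (@eq_Rintegral _ _ _ _ _ (fun z => c * \1_(tame K `&` E) z -
    partial_sum t n z * \1_(tame K `&` E) z)); last first.
    by move=> z _; rewrite mulrBl -!mulrA indicI.
  rewrite RintegralB//; [|by apply: integrable_scale; exact: I1|exact: Ic].
  rewrite RintegralZl//; last exact: I1.
  have mKE : measurable (tame K `&` E) by exact: measurableI.
  rewrite (partial_sum_pairing mS n If df (mindic mKE) (indic1 _)) subr_ge0.
  apply: (@le_trans _ _ (M * \int[mu]_z (\1_(tame K) z * orbit_sum S \1_(tame K `&` E) n z))).
    have mo := measurable_orbit_sum mS n (mindic mKE).
    have bo := orbit_sum_le S n (indic1 (tame K `&` E)).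
    have Io := integrable_mul_bounded (integrable_indic_tame K) mo bo.
    rewrite -RintegralZl//; apply: le_Rintegral => //.
    - exact: integrable_mul_bounded mo bo.
    - exact: integrable_scale.
    - move=> z _; rewrite mulrA ler_wpM2r//; by apply: sumr_ge0.
  rewrite (_ : c * _ = M * (tame_cst K * a n * \int[mu]_z \1_(tame K `&` E) z)).
    by rewrite ler_wpM2l//; apply: tame_visits_le => //; exact: subIsetl.
  by rewrite /c; ring.
by apply: filterS => z + Az; rewrite indicE mem_set// !mulr1 subr_ge0.
Qed.

(** By duality the pairing is the integral of [g] against the dual sums of [f], which converge after
    division by [a n]. Since [g] lives on [tame K], [ae_partial_sum_le] supplies the majorant
    [M * tame_cst K * g] for dominated convergence. *)
Lemma orbit_pairing_cvg K M f g : tame_fun K M f -> tame_fun K M g ->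
  (fun n => (\int[mu]_z (f z * orbit_sum S g n z)) / a n) @ \oo -->
    (\int[mu]_z f z) * (\int[mu]_z g z).
Proof.
move=> tf tg; have If := integrable_tame_fun tf; have Ig := integrable_tame_fun tg.
have [mf f0 fM] := tf; have [mg g0 gM] := tg; have bg := tame_fun_bounded tg.
have [t'] := pde If; move=> /(dual_iterates_ge0 If f0)[t dt t0].
have Ips n : L1 (partial_sum t n) by exact: integrable_sum_nat (dual_integrable dt).
have Ipg n : L1 (fun z => partial_sum t n z * g z) by exact: integrable_mul_bounded bg.
rewrite (_ : (fun n => _) = fun n =>
    \int[mu]_z ((a n)^-1 * (partial_sum t n z * g z))); last first.
  apply/funext => n; rewrite RintegralZl// mulrC.
  by rewrite (partial_sum_pairing mS n If dt mg bg).
rewrite -RintegralZl//.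
have Ig' : L1 (fun z => M * tame_cst K * g z) by exact: integrable_scale.
apply: (Rintegral_dominated _ _ _ Ig' _).2.
- by move=> n; exact: integrable_scale.
- exact: measurable_funM.
- apply: filterS (dual_cvg dt) => z cz.
  under eq_fun do rewrite mulrA.
  exact: cvgMl.
- have := ae_foralln (fun n => ae_partial_sum_le n tf dt).
  apply: filterS => z hz n; rewrite normrM normrM gtr0_norm ?invr_gt0//.
  rewrite (ger0_norm (g0 z)) ger0_norm ?sumr_ge0// mulrA.
  have [Az|nAz] := pselect (tame K z); last by rewrite (tame_fun_notin tg nAz) !mulr0.
  by rewrite ler_wpM2r// mulrC ler_pdivrMr// hz.
Qed.

Lemma indic_tame_fun K : tame_fun K 1 (\1_(tame K)).
Proof. by split=> [|z|z]; [exact: mindic|rewrite indicE|rewrite mul1r]. Qed.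

Lemma orbit_pairing_sum K M f g n : tame_fun K M f -> tame_fun K M g ->
  \int[mu]_z (f z * orbit_sum S g n z) =
  \sum_(0 <= m < n) \int[mu]_z (f z * g (iter m S z)).
Proof.
move=> tf tg; rewrite -Rintegral_sum_nat.
  by under eq_Rintegral do rewrite mulr_sumr.
move=> k; have bg := tame_fun_bounded tg; have [mg _ _] := tg.
apply: (integrable_mul_bounded (integrable_tame_fun tf) _ (fun z => bg (iter k S z))).
exact: (measurable_orbit mS).
Qed.

Context (ra : regularly_varying a 1).

(** The correlations of the indicator of [tame K] with its images along the orbit have partial sums
    asymptotic to [mu (tame K) ^ 2 * a n], so [regularly_varying_dvg] applies to them. *)
Lemma normalisation_dvg K : (0 < mu (tame K))%E -> a n @[n --> \oo] --> +oo.
Proof.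
move=> A0; have tf := indic_tame_fun K.
have := orbit_pairing_cvg tf tf; under eq_fun do rewrite (orbit_pairing_sum _ tf tf).
apply: regularly_varying_dvg => // [m|].
  by apply: Rintegral_ge0 => z _; rewrite mulr_ge0.
have : 0 < fine (mu (tame K)) by rewrite fine_gt0// A0 tame_lty.
by rewrite Rintegral_indic// => h; rewrite mulr_gt0.
Qed.

(** * Preimages of null sets and subinvariance of [mu] *)

Let indic_preimage E z : \1_(S @^-1` E) z = \1_E (S z) :> R.
Proof. by []. Qed.

Let mpre E : measurable E -> measurable (S @^-1` E).
Proof. by move=> mE; rewrite -[X in measurable X]setTI; exact: mS. Qed.

(** The integral of [q] over the preimage of [E] is that of the first dual iterate of [q] over [E],
    hence 0; on each [tame K] the function [q] is bounded below. *)
Lemma preimage_null E : measurable E -> mu E = 0%E -> mu (S @^-1` E) = 0%E.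
Proof.
move=> mE E0; have mSE := mpre mE.
have /cvg_lim <- // := tame_cvg mSE.
apply: lim_near_cst => //; apply: nearW => K.
have q10 : \int[mu]_z (q z * \1_E (S z)) = 0.
  rewrite -(@dual_pairing _ _ _ _ _ _ _ _ dq 1%N _ 1 (mindic mE) (indic1 E)).
  rewrite /Rintegral (ae_eq_integral (cst 0%E)) ?integral0//.
    apply/measurable_EFinP/measurable_funM; last exact: mindic.
    by apply: (@integrable_measurable _ _ _ mu); exact: (dual_integrable dq).
  exists E; split=> // z /= nz; apply: contrapT => nEz; apply: nz => _.
  by rewrite indicE memNset// mulr0.
have mI : measurable (S @^-1` E `&` tame K) by exact: measurableI.
have Iqm : L1 (fun z => q z * \1_E (S z)).
  apply: (integrable_mul_bounded (M := 1)) => //.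
  by apply: (measurable_orbit mS 1); exact: mindic.
have : \int[mu]_z \1_(S @^-1` E `&` tame K) z <= 0.
  apply: (@le_trans _ _ (K.+1%:R * \int[mu]_z (q z * \1_E (S z)))); last first.
    by rewrite q10 mulr0.
  rewrite -RintegralZl//; apply: le_Rintegral => //.
  - by apply: (@integrable_indic_sub K) => //; exact: subIsetr.
  - exact: integrable_scale.
  - move=> z _; rewrite indicI /= indic_preimage mulrC mulrA.
    by rewrite ler_wpM2r// indic_tame_le.
rewrite Rintegral_indic// => h; apply/eqP; rewrite eq_le measure_ge0 andbT.
rewrite -(@fineK _ (mu _)) ?lee_fin// ge0_fin_numE//.
by apply: le_lt_trans (tame_lty K); rewrite le_measure ?inE.
Qed.

Let tame_sub_fin K E : measurable E -> E `<=` tame K -> mu E \is a fin_num.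
Proof.
move=> mE EK; rewrite ge0_fin_numE//; apply: le_lt_trans (tame_lty K).
by rewrite le_measure ?inE.
Qed.

(* The normalised sums of [tq] tend to the constant [c]; truncated at [c] they are
   dominated on the preimage of [E], and pushing them forward by [S] merely shifts
   the sum by one term. *)
Lemma preimage_tame_le i j E : measurable E -> E `<=` tame i ->
  (mu (S @^-1` E `&` tame j) <= mu E)%E.
Proof.
move=> mE Ei; have mSE := mpre mE.
(* A null [E] is separate: otherwise [tame i], which contains [E], has positive measure, and this
   makes [c] positive and [a] divergent. *)
have [E0|E0] := eqVneq (mu E) 0%E.
  rewrite (@subset_measure0 _ _ _ mu _ (S @^-1` E)) ?measure_ge0//.
    exact: measurableI.
  exact: preimage_null.
have Ai0 : (0 < mu (tame i))%E.
  apply: (@lt_le_trans _ _ (mu E)); first by rewrite lt0e E0 measure_ge0.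
  by rewrite le_measure ?inE.
have aoo := normalisation_dvg Ai0.
pose c := \int[mu]_z q z.
have c0 : 0 < c.
  rewrite -(@pmulr_rgt0 _ i.+1%:R)// -RintegralZl//.
  apply: (@lt_le_trans _ _ (fine (mu (tame i)))).
    by rewrite fine_gt0// Ai0 tame_lty.
  rewrite -Rintegral_indic//; apply: le_Rintegral => //.
  - exact: integrable_indic_tame.
  - exact: integrable_scale.
  - by move=> z _; exact: indic_tame_le.
pose F := S @^-1` E `&` tame j.
have mF : measurable F by exact: measurableI.
have IF : L1 (\1_F : X -> R) by apply: (@integrable_indic_sub j) => //; exact: subIsetr.
have IE : L1 (\1_E : X -> R) by exact: (@integrable_indic_sub i).
pose v n z := (a n)^-1 * partial_sum tq n z.
have v0 n z : 0 <= v n z by rewrite mulr_ge0 ?invr_ge0 ?(ltW (a0 n))// sumr_ge0.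
have Iv n : L1 (v n).
  by apply: integrable_scale; exact: integrable_sum_nat (dual_integrable dq).
have IvM n (B : set X) : measurable B -> L1 (fun z => v n z * \1_B z).
  move=> mB; exact: (integrable_mul_bounded (Iv n) (mindic mB) (indic1 B)).
have vpair n (B : set X) : measurable B -> \int[mu]_z (v n z * \1_B z) =
    (a n)^-1 * \int[mu]_z (q z * orbit_sum S \1_B n z).
  move=> mB; rewrite -(partial_sum_pairing mS n Iq dq (mindic mB) (indic1 B)).
  rewrite -RintegralZl//; last first.
    apply: (integrable_mul_bounded _ (mindic mB) (indic1 B)).
    exact: integrable_sum_nat (dual_integrable dq).
  by apply: eq_Rintegral => z _; rewrite mulrA.
have cE : (fun n => \int[mu]_z (v n z * \1_E z)) @ \oo --> c * \int[mu]_z \1_E z.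
  rewrite -RintegralZl//.
  apply: (Rintegral_dominated _ _ _ (integrable_scale i.+1%:R IE) _).2.
  - by move=> n; exact: IvM.
  - by apply: measurable_funM => //; exact: mindic.
  - by apply: filterS (dual_cvg dq) => z cz; exact: cvgMl.
  - apply: aeW => z n; rewrite ger0_norm; last by apply: mulr_ge0.
    rewrite indicE.
    have [/set_mem/Ei[_ h]|_] := boolP (z \in E); last by rewrite !mulr0.
    by rewrite !mulr1 /v mulrC ler_pdivrMr.
pose m n z := Num.min (v n z) c * \1_F z.
have mm n : measurable_fun setT (m n).
  apply: measurable_funM; last exact: mindic.
  by apply: measurable_minr => //; exact: (@integrable_measurable _ _ _ mu).
have mb n z : `|m n z| <= c * \1_F z.
  rewrite normrM (ger0_norm (_ : 0 <= \1_F z))// ler_wpM2r//.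
  by rewrite ger0_norm ?le_min ?v0 ?(ltW c0)// ge_min lexx orbT.
have Im n : L1 (m n).
  by apply: integrable_le (mb n) => //; exact: integrable_scale.
have cF : (fun n => \int[mu]_z (m n z)) @ \oo --> c * \int[mu]_z \1_F z.
  rewrite -RintegralZl//.
  apply: (Rintegral_dominated _ _ _ (integrable_scale c IF) _).2.
  - exact: Im.
  - by apply: measurable_funM => //; exact: mindic.
  - apply: filterS (dual_cvg dq) => z cz; apply: cvgMl.
    exact: cvg_min_limit.
  - exact: aeW.
(* The shifted sum exceeds the original one by at most one term, bounded by 1, whose integral
   against [q] is at most [c]. Divided by [a n], this error disappears in the limit. *)
have le n : \int[mu]_z (m n z) <= \int[mu]_z (v n z * \1_E z) + c / a n.
  apply: (@le_trans _ _ (\int[mu]_z (v n z * \1_(S @^-1` E) z))).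
    apply: le_Rintegral => //; first exact: IvM.
    move=> z _; rewrite /m indicI/=; apply: ler_pM.
    - by rewrite le_min v0 ltW.
    - exact: mulr_ge0.
    - by rewrite ge_min lexx.
    - by rewrite ler_piMr// (le_trans (ler_norm _))// indic1.
  rewrite !vpair// (mulrC c) -mulrDr ler_pM2l ?invr_gt0//.
  have Iqo (B : set X) : measurable B -> L1 (fun z => q z * orbit_sum S \1_B n z).
    move=> mB; apply: (integrable_mul_bounded Iq _ (orbit_sum_le S n (indic1 B))).
    by apply: measurable_orbit_sum => //; exact: mindic.
  rewrite -RintegralD//; [|exact: Iqo]; apply: le_Rintegral => //; first exact: Iqo.
    by apply: integrable_add => //; exact: Iqo.
  move=> z _; rewrite -[X in _ <= _ + X]mulr1 -mulrDr ler_pM2l//.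
  have : orbit_sum S \1_E n.+1 z = \1_E z + orbit_sum S \1_(S @^-1` E) n z :> R.
    by rewrite /orbit_sum big_nat_recl.
  rewrite {1}/orbit_sum big_nat_recr//= => h.
  rewrite -(lerD2l (\1_E z)) -h -/(orbit_sum S \1_E n z) addrCA lerD2l.
  by rewrite (le_trans (ler_norm _))// (le_trans (indic1 _ _))// lerDr.
have : c * \int[mu]_z \1_F z <= c * \int[mu]_z \1_E z + c * 0.
  apply: (ler_cvg_to cF _ (nearW _ le)).
  apply: cvgD => //; apply: cvgMr.
  by apply/gtr0_cvgV0; [exact: nearW|exact: aoo].
rewrite mulr0 addr0 ler_pM2l// !Rintegral_indic//.
move=> h; rewrite -(fineK (tame_sub_fin mF (@subIsetr _ _ _))) -(fineK (tame_sub_fin mE Ei)).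
by rewrite lee_fin.
Qed.

(** Both restrictions of [preimage_tame_le] are removed by exhaustion, first in [j], then in [i]. In
    the second passage the exhausting sets are the preimages of the [tame i], whose union has null
    complement by [preimage_null]. *)
Lemma preimage_le E : measurable E -> (mu (S @^-1` E) <= mu E)%E.
Proof.
move=> mE.
have sub i : (mu (S @^-1` (E `&` tame i)) <= mu E)%E.
  have mEi : measurable (E `&` tame i) by exact: measurableI.
  have cE := tame_cvg (mpre mEi).
  apply: (cvge_to_le cE); apply: nearW => j.
  apply: (le_trans (preimage_tame_le j mEi (@subIsetr _ _ _))).
  by rewrite le_measure ?inE//; exact: subIsetl.
have cS := @exhaustion_cvg _ _ _ mu (fun i => S @^-1` (tame i)) (S @^-1` E).
apply: (cvge_to_le (cS _ _ _ _)); last exact: nearW.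
- by move=> i; exact: mpre.
- by move=> i j ij; apply/subsetPset; apply: preimage_subset; apply/subsetPset; exact: tame_nd.
- rewrite -preimage_bigcup preimage_setC; apply: preimage_null tame_conull.
  by apply: measurableC; exact: bigcupT_measurable.
- exact: mpre.
Qed.

(** * Visits to arbitrary sets and the L^1 bound for orbit sums *)

Let mpre_iter k E : measurable E -> measurable (iter k S @^-1` E).
Proof.
by move=> mE; rewrite -[X in measurable X]setTI; exact: (measurable_iter mS).
Qed.

Let indic_preimage_iter k E z : \1_(iter k S @^-1` E) z = \1_E (iter k S z) :> R.
Proof. by []. Qed.

Lemma tame_visits_measure_le K E n : measurable E -> E `<=` tame K ->
  (\sum_(0 <= k < n) mu (tame K `&` iter k S @^-1` E) <=
   (tame_cst K * a n)%:E * mu E)%E.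
Proof.
move=> mE EK; rewrite -(fineK (tame_sub_fin mE EK)) -EFinM.
have mk k : measurable (tame K `&` iter k S @^-1` E).
  by apply: measurableI => //; exact: mpre_iter.
rewrite (eq_bigr (fun k => (fine (mu (tame K `&` iter k S @^-1` E)))%:E)); last first.
  by move=> k _; rewrite fineK//; apply: tame_sub_fin; [exact: mk|exact: subIsetl].
rewrite sumEFin lee_fin -Rintegral_indic//.
apply: le_trans (tame_visits_le n mE EK).
under [leRHS]eq_Rintegral do rewrite mulr_sumr.
rewrite Rintegral_sum_nat.
  apply: ler_sum => k _; rewrite -Rintegral_indic//.
  rewrite (@eq_Rintegral _ _ _ _ _ (fun z => \1_(tame K) z * \1_E (iter k S z)))//.
  by move=> z _; rewrite indicI/= indic_preimage_iter.
move=> k; apply: (integrable_mul_bounded (integrable_indic_tame K) _ (fun z => indic1 E _)).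
by apply: (measurable_orbit mS); exact: mindic.
Qed.

(* Maximum principle: outside [tame K] the expected number of visits is inherited,
   through the subinvariance of [mu], from one step earlier. *)
Lemma visits_measure_le K E n N : measurable E -> (n <= N)%N ->
  (\sum_(0 <= k < n) mu (tame K `&` iter k S @^-1` E) <=
   (tame_cst K * a N)%:E * mu E)%E.
Proof.
(* The index [N] stays fixed while [n] decreases, since [a] is not assumed monotone. *)
elim: n E => [E mE _|n ih E mE nN].
  rewrite big_geq// mule_ge0// lee_fin mulr_ge0 ?mulr_ge0//; exact: ltW.
have mE1 : measurable (E `&` tame K) by exact: measurableI.
have mE2 : measurable (E `\` tame K) by exact: measurableD.
have split_mu (m : {measure set X -> \bar R}) F : measurable F ->
    m F = (m (F `&` tame K) + m (F `\` tame K))%E.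
  move=> mF; rewrite -measureU ?setUIDK//.
  - exact: measurableI.
  - exact: measurableD.
  - by rewrite setDE setIACA setICr setI0.
rewrite (eq_bigr (fun k => mu (tame K `&` iter k S @^-1` (E `&` tame K)) +
    mu (tame K `&` iter k S @^-1` (E `\` tame K)))%E); last first.
  move=> k _; rewrite -measureU.
  - by rewrite -setIUr -preimage_setU setUIDK.
  - by apply: measurableI => //; exact: mpre_iter.
  - by apply: measurableI => //; exact: mpre_iter.
  - by apply/seteqP; split=> z // [[_ [_ ?]] [_ [_ ?]]].
rewrite big_split/= [in leRHS]split_mu// ge0_muleDr//; apply: leeD.
  apply: le_trans (tame_visits_measure_le N mE1 (@subIsetr _ _ _)).
  rewrite [leRHS](@big_cat_nat _ _ _ n.+1)//= leeDl// sume_ge0//.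
(* At time 0 a point of [tame K] is not in the part of [E] outside it. The remaining times count
   visits to the preimage of that part, one step earlier. *)
rewrite big_nat_recl// [X in (X + _)%E](_ : _ = 0%E) ?add0e; last first.
  by rewrite (_ : _ `&` _ = set0) ?measure0//; apply/seteqP; split=> z // [? []].
apply: (@le_trans _ _ (\sum_(0 <= k < n)
    mu (tame K `&` iter k S @^-1` (S @^-1` (E `\` tame K))))%E).
  by apply: lee_sum.
apply: le_trans (ih _ (mpre mE2) (ltnW nN)) _.
by apply: lee_wpmul2l (preimage_le mE2); rewrite lee_fin mulr_ge0 ?mulr_ge0// ltW.
Qed.

(** The bound on visits is a comparison of measures: the sum of the images of [mu] restricted to
    [tame K] under the iterates of [S] is at most [tame_cst K * a n] times [mu]. Integrating [h]
    against both sides gives the claim. *)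
Lemma integral_orbit_sum_le K h n : measurable_fun setT h -> (forall z, 0 <= h z) ->
  (\int[mu]_(z in tame K) (orbit_sum S h n z)%:E <=
   (tame_cst K * a n)%:E * \int[mu]_z (h z)%:E)%E.
Proof.
move=> mh h0.
have C0 : 0 <= tame_cst K * a n by rewrite mulr_ge0 ?mulr_ge0// ltW.
pose nu k : {measure set X -> \bar R} :=
  measure_function_pushforward__canonical__measure_function_Measure
    (mrestr mu (measurable_tame K)) (measurable_iter mS k).
have mEh : measurable_fun setT (EFin \o h) by exact/measurable_EFinP.
have mEk k : measurable_fun setT (fun z => (h (iter k S z))%:E).
  by apply/measurable_EFinP; exact: measurable_orbit.
under eq_integral do rewrite /orbit_sum -sumEFin.
rewrite ge0_integral_sum//; last 2 first.
- by move=> k; exact: measurable_funTS.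
- by move=> *; rewrite lee_fin.
have nuE k : (\int[mu]_(z in tame K) (h (iter k S z))%:E = \int[nu k]_z (EFin \o h) z)%E.
  rewrite (ge0_integral_pushforward (measurable_iter mS k))//; last first.
    by move=> z _; rewrite lee_fin.
  rewrite preimage_setT (@ge0_negligible_integral _ _ _
    (mrestr mu (measurable_tame K)) setT (~` tame K))//.
  - rewrite setTD setCK; apply: eq_measure_integral => B mB BK.
    by rewrite /= /mrestr setIidl.
  - exact: measurableC.
  - exact: (mEk k).
  - by move=> z _; rewrite lee_fin.
  - by rewrite /= /mrestr setICl measure0.
rewrite (eq_bigr _ (fun k _ => nuE k)) big_mkord -ge0_integral_measure_sum//; last first.
  by move=> z _; rewrite lee_fin.
rewrite -[_%:E]/((NngNum C0)%:num%:E) -ge0_integral_mscale//; last first.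
  by move=> z _; rewrite lee_fin.
have h0e z : (0 <= (h z)%:E)%E by rewrite lee_fin.
apply: ge0_le_measure_integral => // B mB.
rewrite /= /msum /mscale /= -(big_mkord xpredT (fun k => nu k B)).
rewrite (eq_bigr (fun k => mu (tame K `&` iter k S @^-1` B))).
  exact: visits_measure_le.
by move=> k _; rewrite /nu/= /pushforward /mrestr setIC.
Qed.

Let integral_indic_mul E h :
  (\int[mu]_z (\1_E z * h z)%:E = \int[mu]_(z in E) (h z)%:E)%E.
Proof.
rewrite [RHS]integral_mkcond; apply: eq_integral => z _; rewrite /= patchE indicE.
by case: (z \in _); rewrite ?mul1r ?mul0r.
Qed.

Lemma integrable_tame_orbit_sum K h n : L1 h -> (forall z, 0 <= h z) ->
  L1 (fun z => \1_(tame K) z * orbit_sum S h n z).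
Proof.
move=> Ih h0; have mh := integrable_measurable Ih.
have mo := measurable_orbit_sum mS n mh.
have o0 z : 0 <= orbit_sum S h n z by exact: sumr_ge0.
apply/integrableP; split.
  by apply/measurable_EFinP; apply: measurable_funM => //; exact: mindic.
rewrite (eq_integral (fun z => (\1_(tame K) z * orbit_sum S h n z)%:E)); last first.
  by move=> z _; rewrite /= ger0_norm ?mulr_ge0.
rewrite integral_indic_mul; apply: le_lt_trans (integral_orbit_sum_le K n mh h0) _.
by rewrite -EFin_Rintegral// -EFinM ltry.
Qed.

Lemma Rintegral_orbit_sum_le K h n : L1 h -> (forall z, 0 <= h z) ->
  \int[mu]_z (\1_(tame K) z * orbit_sum S h n z) <=
  tame_cst K * a n * \int[mu]_z h z.
Proof.
move=> Ih h0; have mh := integrable_measurable Ih.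
rewrite -lee_fin EFin_Rintegral; last exact: integrable_tame_orbit_sum.
rewrite EFinM EFin_Rintegral//.
apply: le_trans (integral_orbit_sum_le K n mh h0).
by rewrite integral_indic_mul.
Qed.

(** * Second moment and variance *)

(** By [sqr_sum_le] the square is controlled by orbit sums, of length [n - m], of the lag products
    [h m]. These vanish off [B], so for large [n - m] pairing them with the dual sums of the
    indicator costs a factor [(mA + e) * a (n - m)] uniform in [m]. What remains is the convolution
    with [u], at most about half of [c * a n ^ 2]. *)
Lemma second_moment_le K M f B t (eps : R) : tame_fun K M f ->
  (forall z, ~ B z -> f z = 0) -> dual_iterates mu S a \1_(tame K) t ->
  (forall e : R, 0 < e -> exists N, forall n z, (N <= n)%N -> B z ->
    partial_sum t n z <= (fine (mu (tame K)) + e) * a n) ->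
  0 < \int[mu]_z f z -> 0 < eps ->
  \forall n \near \oo, \int[mu]_z (\1_(tame K) z * orbit_sum S f n z ^+ 2) <=
    (fine (mu (tame K)) * (\int[mu]_z f z) ^+ 2 + eps) * a n ^+ 2.
Proof.
move=> tf fB dt tB If0 eps0.
have If := integrable_tame_fun tf; have [mf f0 _] := tf; have bf := tame_fun_bounded tf.
set mA := fine (mu (tame K)); set c := (\int[mu]_z f z) ^+ 2.
have mA0 : 0 <= mA by exact: fine_ge0.
have c0 : 0 < c by rewrite exprn_gt0.
pose h m z := f z * f (iter m S z).
have h0 m z : 0 <= h m z by rewrite mulr_ge0.
have mfi m : measurable_fun setT (fun z => f (iter m S z)) by exact: (measurable_orbit mS).
have bh m z : `|h m z| <= `|M| * `|M| by rewrite normrM ler_pM.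
have Ih m : L1 (h m) by apply: (integrable_mul_bounded If _ (fun z => bf (iter m S z))).
have mh m : measurable_fun setT (h m) by exact: integrable_measurable (Ih m).
pose u m := \int[mu]_z h m z.
have u0 m : 0 <= u m by apply: Rintegral_ge0.
have Ucvg : (fun n => (\sum_(0 <= m < n) u m) / a n) @ \oo --> c.
  rewrite /c expr2; have := orbit_pairing_cvg tf tf.
  by under eq_fun do rewrite (orbit_pairing_sum _ tf tf).
have aoo := regularly_varying_dvg a0 u0 ra c0 Ucvg.
(* Expanding [2 * (mA + e) * (c / 2 + e)] gives [mA * c] plus at most [e * (c + 2 * mA + 2)], using
   [e ^ 2 <= e]; the choice makes this excess at most [eps / 2]. *)
pose e := Num.min 1 (eps / (2 * (c + 2 * mA + 2))).
have D0 : 0 < 2 * (c + 2 * mA + 2) by move: c0 mA0; lra.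
have e0 : 0 < e by rewrite lt_min ltr01 divr_gt0.
have e1 : e <= 1 by rewrite ge_min lexx.
have eD : e * (2 * (c + 2 * mA + 2)) <= eps by rewrite -ler_pdivlMr// ge_min lexx orbT.
have [N0 tN0] := tB e e0.
(* For lengths below [N0] only the crude bound with [tame_cst] is available. Its contribution is a
   constant times the partial sum of [u], of order [a n], hence negligible against [a n ^ 2]. *)
pose C := \sum_(0 <= i < N0) tame_cst K * a i.
have tc0 i : 0 <= tame_cst K * a i by rewrite mulr_ge0 ?mulr_ge0// ltW.
have C0 : 0 <= C by exact: sumr_ge0.
have visits N m : \int[mu]_z (\1_(tame K) z * orbit_sum S (h m) N z) <=
    ((mA + e) * a N + C) * u m.
  have mAe : 0 <= (mA + e) * a N by rewrite mulr_ge0 ?addr_ge0// ltW.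
  have [N0N|NN0] := leqP N0 N; last first.
    apply: (le_trans (Rintegral_orbit_sum_le K N (Ih m) (h0 m))).
    apply: ler_wpM2r; [exact: (u0 m)|rewrite -[leLHS]add0r lerD//].
    rewrite /C (bigD1_seq N)//= ?mem_index_iota ?iota_uniq//.
    by rewrite lerDl sumr_ge0.
  rewrite -(partial_sum_pairing mS N (integrable_indic_tame K) dt (mh m) (bh m)).
  apply: (@le_trans _ _ ((mA + e) * a N * u m)); last first.
    by apply: ler_wpM2r; [exact: u0|rewrite lerDl].
  rewrite -RintegralZl//; apply: le_Rintegral => //.
  - apply: integrable_mul_bounded (bh m) => //.
    exact: integrable_sum_nat (dual_integrable dt).
  - exact: integrable_scale.
  - move=> z _; have [Bz|nB] := pselect (B z); first by rewrite ler_wpM2r// tN0.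
    by rewrite /h fB// !mul0r !mulr0.
have moment n : \int[mu]_z (\1_(tame K) z * orbit_sum S f n z ^+ 2) <=
    2 * ((mA + e) * (\sum_(0 <= m < n) a (n - m)%N * u m) + C * \sum_(0 <= m < n) u m).
  have Io m N := integrable_tame_orbit_sum K N (Ih m) (h0 m).
  have Isum : L1 (fun z => \sum_(0 <= m < n) \1_(tame K) z * orbit_sum S (h m) (n - m) z).
    by apply: integrable_sum_nat => m; exact: Io.
  apply: (@le_trans _ _ (2 * \int[mu]_z
      (\sum_(0 <= m < n) \1_(tame K) z * orbit_sum S (h m) (n - m) z))).
    rewrite -RintegralZl//; apply: le_Rintegral => //.
    - apply: (integrable_mul_bounded (M := (n%:R * `|M|) ^+ 2)).
      + exact: integrable_indic_tame.
      + by apply: measurable_funX; exact: (measurable_orbit_sum mS).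
      + move=> z; rewrite normrX ler_pXn2r ?nnegrE ?mulr_ge0//.
        exact: orbit_sum_le.
    - exact: integrable_scale.
    - move=> z _; rewrite -mulr_sumr [leRHS]mulrCA; apply: ler_wpM2l => //.
      apply: le_trans (sqr_sum_le n (fun k => f0 (iter k S z))) _.
      apply: ler_wpM2l => //; rewrite le_eqVlt; apply/orP; left; apply/eqP.
      apply: eq_bigr => m _; apply: eq_bigr => j _.
      by rewrite /h addnC iterD.
  apply: ler_wpM2l => //; rewrite Rintegral_sum_nat; last by move=> m; exact: Io.
  rewrite !mulr_sumr -big_split/=; apply: ler_sum => m _.
  by apply: le_trans (visits _ _) _; rewrite mulrDl mulrA.
have conv := regularly_varying_convolution a0 u0 ra c0 Ucvg e0.
have lim0 : (fun n => 2 * C * ((\sum_(0 <= m < n) u m) / a n) * (a n)^-1) @ \oo -->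
    2 * C * c * 0.
  apply: cvgM; first exact: cvgMr.
  by apply/gtr0_cvgV0; [exact: nearW|exact: aoo].
near=> n.
apply: le_trans (moment n) _.
have Cn : 2 * C * \sum_(0 <= m < n) u m <= eps / 2 * a n ^+ 2.
  rewrite -ler_pdivrMr ?exprn_gt0// expr2 invfM !mulrA -(mulrA (2 * C)).
  near: n; apply: (cvgr_le _ lim0); rewrite mulr0; exact: divr_gt0.
have convn : \sum_(0 <= m < n) a (n - m)%N * u m <= (c / 2 + e) * a n ^+ 2.
  by near: n; exact: conv.
have mAe : 0 <= mA + e by rewrite addr_ge0// ltW.
have := ler_wpM2l mAe convn.
have a2 : 0 <= a n ^+ 2 by exact: sqr_ge0.
move: Cn; set Un := \sum_(0 <= m < n) u m; set Vn := \sum_(0 <= m < n) _ * _.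
set a2n := a n ^+ 2 => Cn Vle.
have : (2 * (mA + e) * (c / 2 + e) + eps / 2) * a2n <= (mA * c + eps) * a2n.
  apply: ler_wpM2r => //.
  have : e * e <= e by rewrite ler_piMl// ltW.
  by move: eD; nra.
move: Cn Vle; lra.
Unshelve. all: by end_near. Qed.

(** Expanding the square, the three terms have sizes [mA * c ^ 2], [- 2 * mA * c ^ 2] and
    [mA * c ^ 2]. The variance being nonnegative, an upper bound on the second moment suffices. *)
Lemma variance_cvg K M f B t : tame_fun K M f ->
  (forall z, ~ B z -> f z = 0) -> dual_iterates mu S a \1_(tame K) t ->
  (forall e : R, 0 < e -> exists N, forall n z, (N <= n)%N -> B z ->
    partial_sum t n z <= (fine (mu (tame K)) + e) * a n) ->
  0 < \int[mu]_z f z ->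
  (fun n => \int[mu]_z (\1_(tame K) z *
    (orbit_sum S f n z / a n - \int[mu]_z f z) ^+ 2)) @ \oo --> 0.
Proof.
move=> tf fB dt tB If0.
have If := integrable_tame_fun tf; have [mf f0 fM] := tf; have bf := tame_fun_bounded tf.
have IA := integrable_indic_tame K.
set mA := fine (mu (tame K)); set c := \int[mu]_z f z.
have mo n := measurable_orbit_sum mS n mf.
have bo n := orbit_sum_le S n bf.
have Io n : L1 (fun z => \1_(tame K) z * orbit_sum S f n z).
  exact: integrable_mul_bounded (bo n).
have Io2 n : L1 (fun z => \1_(tame K) z * orbit_sum S f n z ^+ 2).
  apply: (integrable_mul_bounded (M := (n%:R * `|M|) ^+ 2)) => //.
  - exact: measurable_funX.
  - by move=> z; rewrite normrX ler_pXn2r ?nnegrE ?mulr_ge0//; exact: bo.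
have VE n : \int[mu]_z (\1_(tame K) z * (orbit_sum S f n z / a n - c) ^+ 2) =
    (\int[mu]_z (\1_(tame K) z * orbit_sum S f n z ^+ 2)) / a n ^+ 2
    - 2 * c * ((\int[mu]_z (\1_(tame K) z * orbit_sum S f n z)) / a n) + c ^+ 2 * mA.
  rewrite (@eq_Rintegral _ _ _ _ _ (fun z =>
      ((a n ^+ 2)^-1 * (\1_(tame K) z * orbit_sum S f n z ^+ 2) -
      2 * c / a n * (\1_(tame K) z * orbit_sum S f n z)) +
      c ^+ 2 * \1_(tame K) z)); last first.
    by move=> z _; field; exact: lt0r_neq0.
  rewrite RintegralD//; last 2 first.
  - by apply: integrable_sub; exact: integrable_scale.
  - exact: integrable_scale.
  rewrite RintegralB//; [|exact: integrable_scale|exact: integrable_scale].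
  rewrite !RintegralZl// Rintegral_indic// -/mA; congr (_ - _ + _); first by rewrite mulrC.
  by rewrite mulrAC mulrA.
(* [orbit_pairing_cvg] takes one constant for both functions; [|M| + 1] serves the indicator as well
   as [f]. *)
have tA : tame_fun K (`|M| + 1) \1_(tame K).
  by have [m1 p1 _] := indic_tame_fun K; split=> // z; rewrite ler_peMl// lerDr.
have tf' : tame_fun K (`|M| + 1) f.
  split=> // z; apply: le_trans (fM z) _; rewrite ler_wpM2r//.
  by rewrite (le_trans (ler_norm M))// lerDl.
have first := orbit_pairing_cvg tA tf'; rewrite Rintegral_indic// -/mA -/c in first.
have lim1 : (fun n => 2 * c *
    ((\int[mu]_z (\1_(tame K) z * orbit_sum S f n z)) / a n)) @ \oo -->
    2 * c * (mA * c) by exact: cvgMr.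
apply/cvgrPdist_le => e e0.
have e20 : 0 < e / 2 by exact: divr_gt0.
have second := second_moment_le tf fB dt tB If0 e20.
near=> n.
rewrite sub0r normrN ger0_norm; last first.
  by apply: Rintegral_ge0 => z _; rewrite mulr_ge0// sqr_ge0.
rewrite VE.
have : (\int[mu]_z (\1_(tame K) z * orbit_sum S f n z ^+ 2)) / a n ^+ 2 <=
    mA * c ^+ 2 + e / 2.
  rewrite ler_pdivrMr ?exprn_gt0//; near: n; exact: second.
have : 2 * c * (mA * c) - e / 2 <=
    2 * c * ((\int[mu]_z (\1_(tame K) z * orbit_sum S f n z)) / a n).
  by near: n; apply: (cvgr_ge _ lim1); rewrite ltrBlDr ltrDl.
set x := _ / a n ^+ 2; set y := 2 * c * (_ / _) => h1 h2.
move: h1 h2; lra.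
Unshelve. all: by end_near. Qed.

(** * Convergence in measure on tame sets, extended to all integrable functions *)

Definition deviation K f n (e : R) : set X := tame K `&`
  [set z | e < `|orbit_sum S f n z / a n - \int[mu]_z f z|].

Definition weak_conv K f := forall e : R, 0 < e ->
  (fun n => mu (deviation K f n e)) @ \oo --> 0%E.

Let mbad K f n (e : R) : measurable_fun setT f -> measurable (deviation K f n e).
Proof.
by move=> mf; apply: measurableI => //; exact: (measurable_orbit_deviation mS).
Qed.

Lemma weak_conv_variance K M f B t : tame_fun K M f ->
  (forall z, ~ B z -> f z = 0) -> dual_iterates mu S a \1_(tame K) t ->
  (forall e : R, 0 < e -> exists N, forall n z, (N <= n)%N -> B z ->
    partial_sum t n z <= (fine (mu (tame K)) + e) * a n) ->
  0 < \int[mu]_z f z -> weak_conv K f.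
Proof.
move=> tf fB dt tB If0 e e0.
have [mf _ _] := tf; have bf := tame_fun_bounded tf.
have Vcvg := variance_cvg tf fB dt tB If0.
apply: cvge0P => [n|r r0]; first exact: measure_ge0.
have de : 0 < r * e ^+ 2 by rewrite mulr_gt0// exprn_gt0.
have : \forall n \near \oo, \int[mu]_z (\1_(tame K) z *
    (orbit_sum S f n z / a n - \int[mu]_z f z) ^+ 2) <= r * e ^+ 2.
  exact: (cvgr_le _ Vcvg _ de).
apply: filterS => n Vn.
have Iv : L1 (fun z => \1_(tame K) z *
    (orbit_sum S f n z / a n - \int[mu]_z f z) ^+ 2).
  apply: (integrable_mul_bounded (integrable_indic_tame K)
    (M := (n%:R * `|M| / a n + `|\int[mu]_z f z|) ^+ 2)).
    apply: measurable_funX; apply: measurable_funB => //.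
    by apply: measurable_funM => //; exact: (measurable_orbit_sum mS).
  move=> z; rewrite normrX ler_pXn2r ?nnegrE ?addr_ge0 ?divr_ge0 ?mulr_ge0 ?(ltW (a0 n))//.
  rewrite (le_trans (ler_normB _ _))// lerD// normrM ler_pM//.
    exact: orbit_sum_le.
  by rewrite gtr0_norm// invr_gt0.
apply: (le_trans (measure_le_Rintegral (mbad _ n _ mf) (exprn_gt0 2 e0) Iv _ _)).
- by move=> z; rewrite mulr_ge0// sqr_ge0.
- move=> z [Az /= ez]; rewrite indicE mem_set// mul1r -[leRHS]real_normK ?num_real//.
  by rewrite ler_pXn2r ?nnegrE ?(ltW e0)// ltW.
- by rewrite lee_fin ler_pdivrMr// exprn_gt0.
Qed.

Lemma weak_conv_sub K f g : L1 f -> L1 g -> weak_conv K f -> weak_conv K g ->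
  weak_conv K (fun z => f z - g z).
Proof.
move=> If Ig cf cg e e0; have e20 : 0 < e / 2 by exact: divr_gt0.
have mf := integrable_measurable If; have mg := integrable_measurable Ig.
have cfg : (fun n => mu (deviation K f n (e / 2)) +
    mu (deviation K g n (e / 2)))%E @ \oo --> (0 + 0)%E.
  by apply: cvgeD => //; [exact: cf|exact: cg].
rewrite adde0 in cfg.
apply: (squeeze_cvge _ (@cvg_cst _ 0%E _ _ _) cfg).
apply: nearW => n; rewrite measure_ge0/=.
apply: le_trans (measureU2 mu (mbad _ n _ mf) (mbad _ n _ mg)).
apply: le_measure; rewrite ?inE.
- by apply: mbad; exact: measurable_funB.
- by apply: measurableU; exact: mbad.
move=> z [Az /= ez].
have [fz|fz] := ltP (e / 2) `|orbit_sum S f n z / a n - \int[mu]_z f z|; first by left.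
right; split=> //=; rewrite ltNge; apply/negP => gz.
move: ez; apply/negP; rewrite -leNgt RintegralB//.
rewrite (_ : orbit_sum S (fun z => f z - g z) n z =
    orbit_sum S f n z - orbit_sum S g n z); last first.
  by rewrite /orbit_sum sumrB.
have -> : (orbit_sum S f n z - orbit_sum S g n z) / a n - (\int[mu]_z f z - \int[mu]_z g z) =
  (orbit_sum S f n z / a n - \int[mu]_z f z) - (orbit_sum S g n z / a n - \int[mu]_z g z).
  by field; exact: lt0r_neq0.
by rewrite (le_trans (ler_normB _ _))// [e in leRHS]splitr lerD.
Qed.

(** The error made by [g] in place of [f] is at most the orbit sum of [|f - g|] divided by [a n],
    whose integral over [tame K] is at most [tame_cst K] times the L^1 distance for every [n];
    Markov's inequality makes it small in measure. *)
Lemma weak_conv_approx K f : L1 f ->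
  (forall r : R, 0 < r -> exists g, [/\ L1 g, weak_conv K g &
     \int[mu]_z `|f z - g z| <= r]) ->
  weak_conv K f.
Proof.
move=> If fg e e0; apply: cvge0P => [n|r r0]; first exact: measure_ge0.
pose C := tame_cst K + 1.
have tc0 : 0 <= tame_cst K by exact: mulr_ge0.
have C0 : 0 < C by rewrite ltr_wpDl.
have e30 : 0 < e / 3 by exact: divr_gt0.
(* The first entry keeps the two integrals within [e / 3]; the second makes Markov's inequality at
   level [e / 3] yield measure at most [r / 2]. *)
have [g [Ig cg fgr]] := fg (Num.min (e / 3) (r / 2 * (e / 3) / C)) ltac:(by
  rewrite lt_min e30/= !mulr_gt0// invr_gt0).
have r20 : 0 < r / 2 by exact: divr_gt0.
have mf := integrable_measurable If; have mg := integrable_measurable Ig.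
pose h z := `|f z - g z|.
have Ih : L1 h by apply: (integrable_norm (integrable_sub If Ig)).
have mh := integrable_measurable Ih.
have h0 z : 0 <= h z by exact: normr_ge0.
pose F n := tame K `&` [set z | e / 3 <= orbit_sum S h n z / a n].
have mF n : measurable (F n).
  apply: measurableI => //; apply: measurable_le_set => //.
  by apply: measurable_funM => //; exact: (measurable_orbit_sum mS).
have muF n : (mu (F n) <= (r / 2)%:E)%E.
  have Io := integrable_tame_orbit_sum K n Ih h0.
  have Ioa := integrable_scale (a n)^-1 Io.
  apply: (le_trans (measure_le_Rintegral (mF n) e30 Ioa _ _)).
  - by move=> z; rewrite !mulr_ge0 ?invr_ge0 ?(ltW (a0 n))// sumr_ge0.
  - by move=> z [Az /= ez]; rewrite indicE mem_set// mul1r [leRHS]mulrC.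
  rewrite lee_fin ler_pdivrMr// RintegralZl// ler_pdivrMl//.
  apply: (le_trans (Rintegral_orbit_sum_le K n Ih h0)).
  rewrite mulrAC [leLHS]mulrC ler_pM2l//.
  have : \int[mu]_z h z <= r / 2 * (e / 3) / C by rewrite (le_trans fgr)// ge_min lexx orbT.
  rewrite ler_pdivlMr//; apply: le_trans.
  by rewrite mulrC ler_wpM2l ?Rintegral_ge0// /C lerDl.
have IfIg : `|\int[mu]_z f z - \int[mu]_z g z| <= e / 3.
  rewrite -RintegralB//; apply: (le_trans (le_normr_Rintegral _ _)) => //.
    exact: integrable_sub.
  by rewrite (le_trans fgr)// ge_min lexx.
apply: filterS (cvge0_le (cg _ e30) r20) => n bn.
apply: (@le_trans _ _ (mu (deviation K g n (e / 3) `|` F n))).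
  apply: le_measure; rewrite ?inE; [exact: mbad|by apply: measurableU => //; exact: mbad|].
  move=> z [Az /= ez].
  have [hz|hz] := leP (e / 3) (orbit_sum S h n z / a n); first by right.
  left; split=> //=; rewrite ltNge; apply/negP => gz.
  move: ez; apply/negP; rewrite -leNgt.
  have -> : orbit_sum S f n z / a n - \int[mu]_z f z =
    (orbit_sum S g n z / a n - \int[mu]_z g z) +
    ((orbit_sum S f n z - orbit_sum S g n z) / a n -
     (\int[mu]_z f z - \int[mu]_z g z)) by field; exact: lt0r_neq0.
  have hh : `|(orbit_sum S f n z - orbit_sum S g n z) / a n| <= orbit_sum S h n z / a n.
    rewrite normrM (gtr0_norm (_ : 0 < (a n)^-1)) ?invr_gt0//.
    rewrite ler_wpM2r ?invr_ge0 ?(ltW (a0 n))//.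
    by rewrite /orbit_sum -sumrB ler_norm_sum.
  rewrite (le_trans (ler_normD _ _))// (le_trans (lerD gz (ler_normB _ _)))//.
  by move: hh hz IfIg; lra.
apply: (le_trans (measureU2 _ _ _)) => //; first exact: mbad.
by rewrite [r in leRHS]splitr EFinD; exact: (leeD bn (muF n)).
Qed.

Lemma weak_conv_nd K j f : (K <= j)%N -> measurable_fun setT f ->
  weak_conv j f -> weak_conv K f.
Proof.
move=> Kj mf cf e e0.
apply: (squeeze_cvge _ (@cvg_cst _ 0%E _ _ _) (cf e e0)).
apply: nearW => n; rewrite measure_ge0/=; apply: le_measure; rewrite ?inE; [exact: mbad..|].
by apply: setSI; apply/subsetPset; exact: tame_nd.
Qed.

Lemma weak_conv0 K : weak_conv K (cst 0).
Proof.
move=> e e0; rewrite (_ : (fun n => _) = cst 0%E); first exact: cvg_cst.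
apply/funext => n; rewrite (_ : deviation _ _ _ _ = set0) ?measure0//.
apply/seteqP; split=> z // [_ /=].
by rewrite /orbit_sum big1// mul0r Rintegral_cst// mul0r subrr normr0 ltNge ltW.
Qed.

(** Egorov's theorem on the finite measure set [tame j], applied to the normalised dual sums of its
    own indicator; [B] is what is left after removing the exceptional set [N]. *)
Lemma uniform_tame_subset j (r : R) : 0 < r -> exists B, [/\ measurable B,
  B `<=` tame j, (mu (tame j `\` B) <= r%:E)%E &
  forall M f, tame_fun j M f -> (forall z, ~ B z -> f z = 0) -> weak_conv j f].
Proof.
move=> r0; have [t dt] := pde (integrable_indic_tame j).
have ct := dual_cvg dt; rewrite Rintegral_indic// in ct.
have mt n : measurable_fun setT (fun z => (a n)^-1 * partial_sum t n z).
  apply: measurable_funM => //; apply: measurable_partial_sum => k.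
  exact: integrable_measurable (dual_integrable dt k).
have [|N [mN muN unif]] := @ae_pointwise_almost_uniform _ _ _ mu
    (fun n z => (a n)^-1 * partial_sum t n z) (cst (fine (mu (tame j)))) (tame j) r
    (fun n => measurable_funTS (mt n)) (measurable_cst _) (measurable_tame j)
    (tame_lty j) _ r0.
  by apply: filterS ct => z cz _.
exists (tame j `\` N); split=> //.
- exact: measurableD.
- apply: (le_trans _ (ltW muN)); apply: le_measure; rewrite ?inE//.
    by apply: measurableD => //; exact: measurableD.
  by move=> z [Az nz]; apply: contrapT => Nz; apply: nz.
move=> M f tf fB; have If := integrable_tame_fun tf; have [mf f0 fM] := tf.
(* The variance argument divides by the size of the integral through the convolution estimate, so a
   nonnegative [f] of integral 0 is handled by approximating it by 0. *)
have [I0|I0] := eqVneq (\int[mu]_z f z) 0; last first.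
  apply: (weak_conv_variance tf fB dt); last by rewrite lt0r I0 Rintegral_ge0.
  move=> e e0.
  have [n0 _ nn0] : \forall n \near \oo, forall z, (tame j `\` N) z ->
      `|fine (mu (tame j)) - (a n)^-1 * partial_sum t n z| < e.
    apply: (unif [set h : X -> R | forall z, (tame j `\` N) z ->
      `|fine (mu (tame j)) - h z| < e]).
    apply/uniform_nbhs; exists [set x : R * R | `|x.1 - x.2| < e]; split=> //.
    by exists e.
  exists n0 => n z nn Bz; have := nn0 n nn z Bz.
  by rewrite distrC => /(le_lt_trans (ler_norm _))/ltW; rewrite lerBlDl mulrC ler_pdivrMr.
apply: weak_conv_approx => // e e0; exists (cst 0); split.
- exact: (integrable0 mu setT).
- exact: weak_conv0.
rewrite (@eq_Rintegral _ _ _ _ _ f) ?I0 ?ltW// => z _.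
by rewrite subr0 ger0_norm.
Qed.

(** Two approximations, each costing [r / 2] in L^1: [f] is cut at height [j] and to [tame j], then
    restricted to the set [B] of [uniform_tame_subset]. Taking [j >= K] lets convergence on [tame j]
    pass to [tame K]. *)
Lemma weak_conv_ge0 K f : L1 f -> (forall z, 0 <= f z) -> weak_conv K f.
Proof.
move=> If f0; apply: weak_conv_approx => // r r0; have mf := integrable_measurable If.
have r20 : 0 < r / 2 by exact: divr_gt0.
pose f1 j z := Num.min (f z) j%:R * \1_(tame j) z.
have mf1 j : measurable_fun setT (fun z => Num.min (f z) j%:R) by exact: measurable_minr.
have f1_ge0 j z : 0 <= f1 j z by rewrite mulr_ge0// le_min f0 ler0n.
have f1_le j z : f1 j z <= f z.
  rewrite /f1 indicE; have [_|_] := boolP (_ \in _); last by rewrite mulr0.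
  by rewrite mulr1 ge_min lexx.
have If1 j : L1 (f1 j).
  apply: (integrable_le _ If); first by apply: measurable_funM => //; exact: mindic.
  by move=> z; rewrite ger0_norm.
have [_ cf1] : L1 f /\ (fun j => \int[mu]_z f1 j z) @ \oo --> \int[mu]_z f z.
  apply: (Rintegral_dominated If1 mf _ If); last first.
    by apply: aeW => z j; rewrite ger0_norm.
  have : mu.-negligible (~` \bigcup_j tame j).
    apply/negligibleP; last exact: tame_conull.
    by apply: measurableC; exact: bigcupT_measurable.
  apply: negligibleS => z /= nc [j _ Aj]; apply: nc.
  apply: cvg_near_cst; near=> i.
  have Ai : tame i z.
    suff : tame j `<=` tame i by exact.
    by apply/subsetPset; apply: tame_nd; near: i; exact: nbhs_infty_ge.
  rewrite /f1 indicE mem_set// mulr1 min_l//.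
  by near: i; exact: nbhs_infty_ger.
have : \forall j \near \oo, (K <= j)%N /\ \int[mu]_z f z - r / 2 <= \int[mu]_z f1 j z.
  near=> j; split; first by near: j; exact: nbhs_infty_ge.
  by near: j; apply: (cvgr_ge _ cf1); rewrite ltrBlDr ltrDl.
move=> /filter_ex [j [Kj fj]].
(* Passing from [f1 j] to [g] changes values by at most [j], and only on [tame j] outside [B]; the
   divisor [j.+1] compensates this height and is nonzero even for [j = 0]. *)
have rj0 : 0 < r / 2 / j.+1%:R by rewrite divr_gt0.
have [B [mB Bj muB cB]] := uniform_tame_subset j rj0.
pose g z := Num.min (f z) j%:R * \1_B z.
have mg : measurable_fun setT g by apply: measurable_funM => //; exact: mindic.
have tg : tame_fun j j%:R g.
  split=> // z; first by rewrite mulr_ge0// le_min f0 ler0n.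
  rewrite /g !indicE; have [/set_mem/Bj Az|_] := boolP (z \in B); last first.
    by rewrite mulr0 mulr_ge0.
  by rewrite mem_set// !mulr1 ge_min lexx orbT.
have Ig := integrable_tame_fun tg.
exists g; split=> //.
  apply: weak_conv_nd Kj mg _; apply: cB tg _ => z nB.
  by rewrite /g indicE memNset// mulr0.
have mD : measurable (tame j `\` B) by exact: measurableD.
have ID : L1 (\1_(tame j `\` B) : X -> R) by apply: (@integrable_indic_sub j) => // z [].
have Irhs : L1 (fun z => (f z - f1 j z) + j%:R * \1_(tame j `\` B) z).
  by apply: integrable_add; [exact: integrable_sub|exact: integrable_scale].
apply: (@le_trans _ _ (\int[mu]_z ((f z - f1 j z) + j%:R * \1_(tame j `\` B) z))).
  apply: le_Rintegral => //; first by apply: integrable_norm; exact: integrable_sub.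
  move=> z _; have gf : g z <= f1 j z.
    rewrite /g /f1 ler_wpM2l ?le_min ?f0 ?ler0n// !indicE.
    by have [/set_mem/Bj Az|_] := boolP (z \in B); [rewrite mem_set|exact: ler0n].
  rewrite ger0_norm; last by rewrite subr_ge0 (le_trans gf).
  rewrite -addrA lerD2l -lerBlDl opprK [leLHS]addrC /f1 /g -mulrBr.
  rewrite !indicE in_setD; have [Az|nA] := boolP (z \in tame j).
    have [Bz|nB] := boolP (z \in B); first by rewrite subrr !mulr0.
    by rewrite subr0 !mulr1 ge_min lexx orbT.
  have -> : z \in B = false.
    by apply/negP => /set_mem/Bj Az; move/negP : nA; apply; exact/mem_set.
  by rewrite subrr !mulr0.
rewrite RintegralD//; [|exact: integrable_sub|exact: integrable_scale].
rewrite RintegralB// RintegralZl// Rintegral_indic// [leRHS]splitr lerD//.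
  by rewrite lerBlDr -lerBlDl.
have : fine (mu (tame j `\` B)) <= r / 2 / j.+1%:R.
  by rewrite -lee_fin fineK//; apply: (@tame_sub_fin j) => // z [].
rewrite ler_pdivlMr// mulrC; apply: le_trans; rewrite ler_wpM2r ?fine_ge0//.
by rewrite ler_nat.
Unshelve. all: by end_near. Qed.

Lemma weak_conv_integrable K f : L1 f -> weak_conv K f.
Proof.
move=> If; have pos g : L1 g -> L1 (fun z => Num.max (g z) 0).
  move=> Ig; have mg := integrable_measurable Ig.
  apply: (integrable_le _ (integrable_norm Ig)); first exact: measurable_maxr.
  by move=> z; rewrite ger0_norm ?le_max ?lexx ?orbT// ge_max ler_norm normr_ge0.
have Ip := pos _ If.
have In : L1 (fun z => Num.max (- f z) 0).
  apply: pos; have := integrable_scale (-1) If; apply: eq_integrable => // z _.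
  by rewrite /= mulN1r.
rewrite (_ : f = fun z => Num.max (f z) 0 - Num.max (- f z) 0).
  by apply: weak_conv_sub => //; apply: weak_conv_ge0 => // z; rewrite le_max lexx orbT.
apply/funext => z; have [h|h] := leP 0 (f z).
  by rewrite max_r ?subr0// oppr_le0.
by rewrite max_l ?oppr_ge0 ?(ltW h)// sub0r opprK.
Qed.

End weak_law.

(** * Transfer to a finite measure dominated by [mu] *)

Section absolute_continuity.
Context d (X : measurableType d) (R : realType).
Context (nu mu : {measure set X -> \bar R}).

(* Otherwise some subsequence has summable [mu]-measure and [nu]-measure bounded
   below, contradicting the Borel-Cantelli lemma. *)
Lemma null_dominates_cvg0 (F : (set X)^nat) : (nu setT < +oo)%E -> nu `<< mu ->
  (forall n, measurable (F n)) -> (fun n => mu (F n)) @ \oo --> 0%E ->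
  (fun n => nu (F n)) @ \oo --> 0%E.
Proof.
move=> nuoo /null_content_dominatesP numu mF muF.
apply: cvge0P => [n|e e0]; first exact: measure_ge0.
apply: contrapT => nnear.
have ex k : exists n, (mu (F n) <= (1 / (2 ^ k.+1)%:R)%:E)%E /\ (e%:E < nu (F n))%E.
  have k0 : 0 < 1 / (2 ^ k.+1)%:R :> R by rewrite divr_gt0// ltr0n expn_gt0.
  have small : \forall n \near \oo, (mu (F n) <= (1 / (2 ^ k.+1)%:R)%:E)%E
    by exact: cvge0_le muF k0.
  apply: contrapT => nex; apply: nnear; apply: filterS small => n mun.
  by rewrite leNgt; apply/negP => nun; apply: nex; exists n.
have [phi phiP] := choice ex.
pose G k := F (phi k).
have mG k : measurable (G k) by exact: mF.
have sumG : (\sum_(k <oo) mu (G k) < +oo)%E.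
  apply: (@le_lt_trans _ _ 1%:E); last exact: ltry.
  apply: (le_trans _ (epsilon_trick0 xpredT ler01)).
  by apply: lee_nneseries => // k _; exact: (phiP k).1.
have nuG0 : nu (lim_sup_set G) = 0%E.
  apply: numu; last exact: lim_sup_set_cvg0.
  apply: bigcapT_measurable => n; exact: bigcup_measurable.
have Goo : (nu (\bigcup_(k >= 0) G k) < +oo)%E.
  by apply: le_lt_trans nuoo; apply: le_measure; rewrite ?inE//; exact: bigcup_measurable.
have := lim_sup_set_cvg nu G mG Goo; rewrite nuG0 => cG.
have : (e%:E <= 0)%E.
  apply: (cvge_to_ge cG); apply: nearW => n.
  apply: (le_trans (ltW (phiP n).2)); apply: le_measure; rewrite ?inE//.
    exact: bigcup_measurable.
  by move=> z Gz; exists n => //=.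
by rewrite lee_fin leNgt e0.
Qed.

End absolute_continuity.

Section weak_law_dominated.
Context d (X : measurableType d) (R : realType) (mu nu : {measure set X -> \bar R}).
Context (S : X -> X) (mS : measurable_fun setT S) (a : R^nat).
Local Notation L1 f := (mu.-integrable setT (EFin \o f)).

(** As [nu] is finite, the complement of [tame K] has small [nu]-measure for some [K]; inside that
    set the deviations have vanishing [mu]-measure, hence vanishing [nu]-measure by
    [null_dominates_cvg0]. *)
Theorem dual_ergodic_weak_law (q f : X -> R) (e : R) : (nu setT < +oo)%E -> nu `<< mu ->
  (forall n, 0 < a n) -> regularly_varying a 1 ->
  (forall p : X -> R, L1 p -> exists t, dual_iterates mu S a p t) ->
  (forall z, 0 < q z) -> L1 q -> L1 f -> 0 < e ->
  (fun n => nu [set z | e < `|orbit_sum S f n z / a n - \int[mu]_z f z|]) @ \oo --> 0%E.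
Proof.
move=> nuoo numu a0 ra pde q0 Iq If e0.
have [t' /(dual_iterates_ge0 Iq (fun z => ltW (q0 z)))[tq dq tq0]] := pde q Iq.
pose A := tame a q tq.
have mA K : measurable (A K) by exact: (measurable_tame Iq dq).
have mf := integrable_measurable If.
pose F n := [set z | e < `|orbit_sum S f n z / a n - \int[mu]_z f z|].
have mF n : measurable (F n) by exact: (measurable_orbit_deviation mS).
have nuA : nu (~` \bigcup_K A K) = 0%E.
  move/null_content_dominatesP : (numu); apply.
    by apply: measurableC; exact: bigcupT_measurable.
  exact: (tame_conull a0 q0 Iq dq).
have cA : (fun K => nu (~` A K)) @ \oo --> 0%E.
  have -> : 0%E = nu (\bigcap_K ~` A K) by rewrite -setC_bigcup.
  apply: nonincreasing_cvg_mu => //.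
  - by apply: le_lt_trans nuoo; apply: le_measure; rewrite ?inE//; exact: measurableC.
  - by move=> K; exact: measurableC.
  - by apply: bigcapT_measurable => K; exact: measurableC.
  - move=> K j Kj; apply/subsetPset/subsetC/subsetPset.
    by apply: tame_nd.
apply: cvge0P => [n|r r0]; first exact: measure_ge0.
have r20 : 0 < r / 2 by exact: divr_gt0.
have [K nuK] : exists K, (nu (~` A K) <= (r / 2)%:E)%E.
  exact: filter_ex (cvge0_le cA r20).
have cK : (fun n => nu (A K `&` F n)) @ \oo --> 0%E.
  apply: (null_dominates_cvg0 nuoo numu) => [n|]; first exact: measurableI.
  exact: (weak_conv_integrable mS a0 q0 Iq dq tq0 pde ra K If).
apply: filterS (cvge0_le cK r20) => n le1.
apply: (@le_trans _ _ (nu ((A K `&` F n) `|` ~` A K))).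
  apply: le_measure; [exact/mem_set/mF|apply/mem_set|].
    by apply: measurableU; [exact: measurableI|exact: measurableC].
  by move=> z Fz; have [Az|nA] := pselect (A K z); [left|right].
apply: (le_trans (measureU2 _ _ _)); [exact: measurableI|exact: measurableC|].
by rewrite [r in leRHS]splitr EFinD; exact: (leeD le1 nuK).
Qed.

End weak_law_dominated.

(** * The triangle map *)

Section triangle_system.
Context (R : realType).
Implicit Types (z : plane R) (E : set (plane R)).

Let x_ z : R := z.1.
Let y_ z : R := z.2.
Let mx : measurable_fun setT x_. Proof. exact: measurable_fst. Qed.
Let my : measurable_fun setT y_. Proof. exact: measurable_snd. Qed.

Let minv (f : plane R -> R) : measurable_fun setT f ->
  measurable_fun setT (fun z => (f z)^-1).
Proof. by move=> mf; exact: (measurableT_comp (@measurable_invr R) mf). Qed.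

Lemma measurable_Gamma0 : measurable (@Gamma0 R).
Proof.
rewrite (_ : @Gamma0 R = [set z | x_ z <= 1] `&` [set z | y_ z <= x_ z] `&`
    ~` [set z | y_ z <= 1 - x_ z]); last first.
  apply/seteqP; split=> z /=.
    by case=> ? ? h; split=> //; apply/negP; rewrite -ltNge.
  by case=> -[? ?] /negP; rewrite -ltNge.
apply: measurableI; first by apply: measurableI; exact: measurable_le_set.
apply: measurableC; apply: measurable_le_set => //; exact: measurable_funB.
Qed.

Lemma measurable_Smap : measurable_fun setT (@Smap R).
Proof.
apply: measurable_fun_ifT.
- apply: (measurable_fun_bool true); rewrite setTI.
  rewrite (_ : _ @^-1` _ = @Gamma0 R); first exact: measurable_Gamma0.
  by apply/seteqP; split=> z /=; [move/set_mem|move/mem_set].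
- apply: measurable_fun_pair; apply: measurable_funM => //; first exact: minv.
    exact: measurable_funB.
  exact: minv.
- apply: measurable_fun_pair; apply: measurable_funM => //; apply: minv.
    exact: measurable_funB.
  exact: measurable_funB.
Qed.

Lemma Smap_triangle z : triangle z -> triangle (Smap z).
Proof.
case: z => x y [/= x1 yx y0]; rewrite /Smap/=.
case: ifPn => [/set_mem[/= _ _ xy]|nG].
  have x0 : 0 < x by lra.
  split=> /=.
  - by rewrite ler_pdivrMr// mul1r.
  - by rewrite ler_pM2r ?invr_gt0//; exact: ltW.
  - by rewrite divr_ge0 ?subr_ge0// ltW.
have xy : y <= 1 - x.
  rewrite leNgt; apply/negP => xy; move/negP: nG; apply; apply/mem_set.
  by split.
have y1 : 0 < 1 - y by lra.
split=> /=.
- by rewrite ler_pdivrMr// mul1r; lra.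
- by rewrite ler_pM2r ?invr_gt0.
- by rewrite divr_ge0// ltW.
Qed.

Lemma iter_Smap_triangle k z : triangle z -> triangle (iter k Smap z).
Proof. by move=> tz; elim: k => //= k; exact: Smap_triangle. Qed.

Lemma leb2_triangle : (leb2 (@triangle R) <= 1)%E.
Proof.
apply: (@le_trans _ _ (leb2 (`[0, 1]%classic `*` `[0, 1]%classic : set (plane R)))).
  apply: le_measure; rewrite ?inE; first exact: measurable_triangle.
    exact: measurableX.
  move=> [x y] [/= x1 yx y0]; split; rewrite /= in_itv /=; apply/andP; split=> //.
    exact: le_trans yx.
  exact: le_trans x1.
have -> : leb2 (`[0, 1]%classic `*` `[0, 1]%classic : set (plane R)) =
    (@lebesgue_measure R `[0%R, 1%R]%classic * @lebesgue_measure R `[0%R, 1%R]%classic)%E.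
  exact: product_measure1E.
by rewrite lebesgue_measure_itv/= lte_fin ltr01 oppr0 adde0 mul1e.
Qed.

Let dens z : R := (x_ z * y_ z)^-1.
Let mdens : measurable_fun setT dens.
Proof. by apply: minv; exact: measurable_funM. Qed.

Let dens_ge0 z : triangle z -> 0 <= dens z.
Proof. by case=> _ yx y0; rewrite invr_ge0 mulr_ge0// (le_trans y0). Qed.

Lemma mu_notin_triangle : mu (~` @triangle R) = 0%E.
Proof. by rewrite /mu setICl integral_set0. Qed.

Definition open_triangle : set (plane R) := triangle `&` [set z | 0 < (z.2 : R)].

Lemma measurable_open_triangle : measurable open_triangle.
Proof.
apply: measurableI; first exact: measurable_triangle.
exact: (measurable_gt_set 0 my).
Qed.

(** On the segment [y = 0] the inverse takes its default value 0, so the density vanishes there. *)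
Lemma mu_notin_open_triangle : mu (~` open_triangle) = 0%E.
Proof.
rewrite /mu; apply: integral0_eq => z [nz tz].
have -> : (z.2 : R) = 0.
  apply/eqP; rewrite eq_le; case: (tz) => _ _ ->; rewrite andbT leNgt; apply/negP => h.
  by apply: nz.
by rewrite mulr0 invr0.
Qed.

Lemma open_triangle_gt0 z : open_triangle z -> 0 < x_ z * y_ z <= 1.
Proof.
case=> -[x1 yx _] y0; have x0 : 0 < x_ z by exact: lt_le_trans yx.
by rewrite mulr_gt0//= mulr_ile1 ?(ltW x0) ?(ltW y0)// (le_trans yx).
Qed.

(* Almost everywhere this is the inverse of the density of [mu], so that its integral
   is the area of the triangle; the value 1 keeps it positive on the null complement. *)
Definition weight z : R := if z \in open_triangle then x_ z * y_ z else 1.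

Lemma weight_gt0 z : 0 < weight z.
Proof. by rewrite /weight; case: ifPn => // /set_mem/open_triangle_gt0/andP[]. Qed.

Lemma measurable_weight : measurable_fun setT weight.
Proof.
apply: measurable_fun_ifT => //; last exact: measurable_funM.
apply: (measurable_fun_bool true); rewrite setTI.
rewrite (_ : _ @^-1` _ = open_triangle); first exact: measurable_open_triangle.
by apply/seteqP; split=> z /=; [move/set_mem|move/mem_set].
Qed.

(** The open triangle is cut into slices [Z i] by the integer part of the density. On [Z i] the
    measure [mu] is at most [i.+1] times Lebesgue measure and the weight at most [2 / i.+1], because
    [i * x * y <= 1] and [x * y <= 1]. Each slice thus contributes at most twice its area. *)
Lemma integrable_weight : (mu (R:=R)).-integrable setT (EFin \o weight).
Proof.
apply/integrableP; split; first by apply/measurable_EFinP; exact: measurable_weight.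
have wE z : `|(weight z)%:E|%E = (weight z)%:E by rewrite gee0_abs// lee_fin ltW// weight_gt0.
rewrite (eq_integral (fun z => (weight z)%:E)); last by move=> z _; exact: wE.
have mw : measurable_fun setT (fun z => (weight z)%:E).
  by apply/measurable_EFinP; exact: measurable_weight.
have w0 z : (0 <= (weight z)%:E)%E by rewrite lee_fin ltW// weight_gt0.
rewrite (@ge0_negligible_integral _ _ _ _ setT (~` open_triangle))//; last 2 first.
- by apply: measurableC; exact: measurable_open_triangle.
- exact: mu_notin_open_triangle.
rewrite setTD setCK.
pose Z i := open_triangle `&` (dens @^-1` `[i%:R, i.+1%:R[%classic).
have mZ i : measurable (Z i).
  apply: measurableI; first exact: measurable_open_triangle.
  by rewrite -[X in measurable X]setTI; exact: mdens.
have dens1 z : open_triangle z -> 1 <= dens z.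
  by move/open_triangle_gt0 => /andP[h0 h1]; rewrite invf_ge1.
have ZE : open_triangle = \bigcup_i Z i.
  apply/seteqP; split=> [z oz|z [i _ []]//].
  exists (Num.truncn (dens z)) => //; split=> //=; rewrite in_itv/=.
  by apply: truncn_itv; rewrite (le_trans _ (dens1 z oz)).
have tZ : trivIset setT Z.
  apply/trivIsetP => i j _ _ ij; apply/seteqP; split=> z //.
  rewrite /Z /= !in_itv/= => -[[_ zi] [_ zj]].
  move: ij; rewrite -(truncn_def zi) -(truncn_def zj) eqxx//.
rewrite ZE ge0_integral_bigcup//; last first.
  by apply: measurable_funTS.
have Zle i : (\int[mu]_(z in Z i) (weight z)%:E <= 2%:E * leb2 (Z i))%E.
  have muZ : (mu (Z i) <= i.+1%:R%:E * leb2 (Z i))%E.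
    rewrite /mu setIidl; last by move=> z [[]].
    rewrite -integral_cst//; apply: ge0_le_integral => //.
    - by move=> z [[tz _] _]; rewrite lee_fin; exact: dens_ge0.
    - exact/measurable_funTS/measurable_EFinP.
    - by move=> z [_ /=]; rewrite in_itv/= lee_fin => /andP[_ /ltW].
  apply: (@le_trans _ _ (\int[mu]_(z in Z i) (2 / i.+1%:R)%:E)%E).
    apply: ge0_le_integral => //.
    - by apply: measurable_funTS.
    - move=> z [oz /=]; rewrite in_itv/= lee_fin => /andP[iz _].
      have /andP[w0' w1] := open_triangle_gt0 oz.
      rewrite /weight mem_set// ler_pdivlMr//; move: iz.
      by rewrite /dens -[X in _ <= X]mul1r ler_pdivlMr// -natr1; move: w1; lra.
  rewrite integral_cst//.
  apply: (@le_trans _ _ ((2 / i.+1%:R)%:E * (i.+1%:R%:E * leb2 (Z i)))%E).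
    by apply: lee_wpmul2l => //; rewrite lee_fin.
  by rewrite muleA -EFinM -mulrA mulVf ?mulr1.
apply: (@le_lt_trans _ _ (\sum_(i <oo) (2%:E * leb2 (Z i)))%E).
  by apply: lee_nneseries => [i *|i _]; [exact: integral_ge0|exact: Zle].
rewrite nneseriesZl// -measure_semi_bigcup//; last exact: bigcupT_measurable.
rewrite -ZE; apply: (@le_lt_trans _ _ (2%:E * 1)%E); last by rewrite mule1 ltry.
apply: lee_wpmul2l => //; apply: (le_trans _ leb2_triangle).
apply: le_measure; rewrite ?inE; [exact: measurable_open_triangle|exact: measurable_triangle|].
by move=> z [].
Qed.

(** A [mu]-null set is covered by three pieces: its part in the open triangle, Lebesgue-null since
    the density is positive there; the segment [y = 0], Lebesgue-null; and the complement of the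
    triangle, not charged by [nu]. *)
Lemma leb2_dominated (nu : {measure set (plane R) -> \bar R}) :
  nu (~` triangle) = 0%E -> nu `<< leb2 -> nu `<< mu (R:=R).
Proof.
move=> PC /null_content_dominatesP Pac; apply/null_content_dominatesP => E mE muE.
have mtri := @measurable_triangle R; have mot := measurable_open_triangle.
pose axis : set (plane R) :=
  (setT : set (measurableTypeR R)) `*` ([set 0] : set (measurableTypeR R)).
have axis0 : leb2 axis = 0%E.
  transitivity (@lebesgue_measure R setT * @lebesgue_measure R [set 0%R])%E.
    exact: product_measure1E.
  by rewrite lebesgue_measure_set1 mule0.
have Py : nu (triangle `\` open_triangle) = 0%E.
  apply: Pac; first exact: measurableD.
  apply: subset_measure0 axis0.
  - exact: measurableD.
  - exact: measurableX.
  - move=> [x y] [[/= x1 yx y0] no]; split=> //=; apply/eqP.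
    by rewrite eq_le y0 andbT leNgt; apply/negP => y0'; apply: no.
have PE : nu (E `&` open_triangle) = 0%E.
  apply: Pac; first exact: measurableI.
  have mEt : measurable (E `&` triangle) by exact: measurableI.
  have : ae_eq leb2 (E `&` triangle) (fun z => (dens z)%:E) (cst 0%E).
    apply/ae_eq_integral_abs => //.
      exact/measurable_funTS/measurable_EFinP.
    rewrite -[RHS]muE; apply: eq_integral => z /set_mem[_ tz].
    by rewrite gee0_abs// lee_fin; exact: dens_ge0.
  move=> [N [mN N0 NP]]; apply: (subset_measure0 _ mN _ N0).
    exact: measurableI.
  move=> z [Ez oz]; apply: NP => /= h.
  have /andP[xy0 _] := open_triangle_gt0 oz.
  have := h (conj Ez (proj1 oz)); case=> /eqP; rewrite invr_eq0 => /eqP xy.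
  by rewrite xy ltxx in xy0.
have mD : measurable (triangle `\` open_triangle) by exact: measurableD.
have mC : measurable (~` @triangle R) by exact: measurableC.
have mI : measurable (E `&` open_triangle) by exact: measurableI.
have PDC : nu ((triangle `\` open_triangle) `|` ~` triangle) = 0%E.
  exact: etrans (measureU0 mD mC PC) Py.
have mDC := measurableU _ _ mD mC.
apply: (subset_measure0 mE (measurableU _ _ mI mDC)); last first.
  exact: etrans (measureU0 mI mDC PDC) PE.
move=> z Ez; have [oz|noz] := pselect (open_triangle z); first by left.
by right; have [tz|ntz] := pselect (triangle z); [left|right].
Qed.

Lemma Rintegral_triangle (f : plane R -> R) : mu.-integrable setT (EFin \o f) ->
  \int[mu]_(z in triangle) f z = \int[mu]_z f z.
Proof.
move=> If; have mtri := @measurable_triangle R; rewrite /Rintegral; congr fine.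
rewrite [RHS](@negligible_integral _ _ _ _ setT (~` triangle))//.
- by rewrite setTD setCK.
- exact: measurableC.
- exact: mu_notin_triangle.
Qed.

Lemma L1mu_patch (f : plane R -> R) : L1mu f -> mu.-integrable setT (EFin \o (f \_ triangle)).
Proof.
move=> If; have mtri := @measurable_triangle R.
rewrite -restrict_EFin; apply/integrable_restrict => //; by rewrite setTI.
Qed.

Context (T : (plane R -> R) -> (plane R -> R)) (T_transfer : is_transfer_operator T).

Lemma L1mu_iter (p : plane R -> R) k : L1mu p -> L1mu (iter k T p).
Proof. by move=> Ip; elim: k => //= k ih; have [] := T_transfer ih. Qed.

Lemma bounded_Linfty (h : plane R -> R) (M : R) : measurable_fun setT h ->
  (forall z, `|h z| <= M) -> Linfty_mu h.
Proof.
move=> mh hM; split; first exact: measurable_funTS.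
apply: (@le_lt_trans _ _ M%:E); last exact: ltry.
by apply/ess_supP; apply: aeW => z; rewrite lee_fin.
Qed.

Lemma transfer_iter (p h : plane R -> R) (M : R) k : L1mu p ->
  measurable_fun setT h -> (forall z, `|h z| <= M) ->
  \int[mu]_(z in triangle) (iter k T p z * h z) =
  \int[mu]_(z in triangle) (p z * h (iter k Smap z)).
Proof.
move=> Ip; elim: k h => // k ih h mh hM.
have [_ ->] := T_transfer (L1mu_iter k Ip); last exact: bounded_Linfty hM.
rewrite (ih (h \o Smap))//; first exact: (measurableT_comp mh measurable_Smap).
by move=> z; exact: hM.
Qed.

(** The general theory integrates over the whole space, so the iterates are set to 0 off the
    triangle, a [mu]-null set. *)
Lemma transfer_dual_iterates (a : R^nat) (p : plane R -> R) : dual_ergodic_sequence T a ->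
  mu.-integrable setT (EFin \o p) -> exists t, dual_iterates mu Smap a p t.
Proof.
move=> [a0 aT] Ip; have mtri := @measurable_triangle R.
have Lp : L1mu p by exact: integrableS Ip.
exists (fun k => iter k T p \_ triangle); split.
- by move=> k; apply: L1mu_patch; exact: L1mu_iter.
- move=> k h M mh hM; have Lk := L1mu_iter k Lp.
  rewrite -Rintegral_triangle; last first.
    exact: integrable_mul_bounded (L1mu_patch Lk) mh hM.
  rewrite -Rintegral_triangle; last first.
    apply: (integrable_mul_bounded Ip _ (fun z => hM (iter k Smap z))).
    exact: (measurable_orbit measurable_Smap).
  rewrite -(transfer_iter k Lp mh hM); apply: eq_Rintegral => z zt.
  by rewrite patchE zt.
- have nt : {ae mu, forall z, triangle z}.
    by apply/negligibleP; [exact: measurableC|exact: mu_notin_triangle].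
  apply: filterS2 nt (aT p Lp) => z tz /(_ tz).
  rewrite Rintegral_triangle//; apply: cvg_trans; apply: near_eq_cvg; apply: nearW => n.
  by congr (_ * _); apply: eq_bigr => k _; rewrite patchE mem_set.
Qed.

End triangle_system.

Unset Implicit Arguments.
Set Strict Implicit.

Theorem theorem3p2 (R : realType)
    (Prob : probability (plane R) R)
    (Prob_triangle : Prob triangle = 1%E)
    (Prob_ac : Prob `<< leb2)
    (T : (plane R -> R) -> (plane R -> R))
    (T_transfer : is_transfer_operator T)
    (a : R^nat)
    (a_dual_ergodic : dual_ergodic_sequence T a)
    (a_regular : regularly_varying a 1) :
  forall f : plane R -> R, L1mu f ->
  forall eps : R, 0 < eps ->
    (fun n : nat => Prob [set z | triangle z /\
      `|(a n)^-1 * \sum_(0 <= k < n) f (iter k Smap z) -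
        \int[mu]_(w in triangle) f w| > eps]) @ \oo --> 0%E.
Proof.
move=> f Lf eps eps0; have mtri := @measurable_triangle R.
(* Extending [f] by 0 leaves orbit sums started in the triangle unchanged, since [Smap] maps the
   triangle into itself. *)
pose f' := f \_ triangle.
have If' : mu.-integrable setT (EFin \o f') by exact: L1mu_patch.
have mf' := integrable_measurable If'.
have intE : \int[mu]_(w in triangle) f w = \int[mu]_w f' w by rewrite Rintegral_mkcond.
pose bad n := [set z : plane R | eps < `|orbit_sum Smap f' n z / a n - \int[mu]_w f' w|].
have badE n : [set z | triangle z /\ `|(a n)^-1 * \sum_(0 <= k < n) f (iter k Smap z) -
        \int[mu]_(w in triangle) f w| > eps] = triangle `&` bad n.
  have sumE z : triangle z -> (a n)^-1 * \sum_(0 <= k < n) f (iter k Smap z) =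
      orbit_sum Smap f' n z / a n.
    move=> tz; rewrite mulrC; congr (_ / _); apply: eq_bigr => k _.
    by rewrite /f' patchE mem_set//; exact: iter_Smap_triangle.
  by apply/seteqP; split=> z [tz /=] h; split=> //; move: h; rewrite /bad/= sumE// intE.
under eq_fun do rewrite badE.
have mbad n : measurable (bad n).
  exact: (measurable_orbit_deviation (@measurable_Smap R)).
have Pbad : (fun n => Prob (bad n)) @ \oo --> 0%E.
  apply: (dual_ergodic_weak_law (@measurable_Smap R) _ _ _ a_regular _
    (@weight_gt0 R) (@integrable_weight R) If' eps0).
  - by apply: (@le_lt_trans _ _ 1%E); [exact: probability_le1|exact: ltry].
  - apply: leb2_dominated => //.
    have PC := probability_setC Prob mtri; rewrite Prob_triangle subee// in PC.
  - by have [] := a_dual_ergodic.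
  - by move=> p Ip; exact: (transfer_dual_iterates T_transfer a_dual_ergodic Ip).
apply: (squeeze_cvge _ (@cvg_cst _ 0%E _ _ _) Pbad).
apply: nearW => n; rewrite measure_ge0/=.
apply: le_measure; [apply/mem_set|apply/mem_set|by move=> z []].
  exact: measurableI.
exact: mbad.
Qed.
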